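(* Let $\theta$ be a skew diagram, let $\mu,\nu$ be partitions with $\ell(\nu)\le n$, and let $c_{\theta\mu}^{\nu}\in\mathbb{F}(\beta)$ be the coefficients defined by $$G_\theta(x)\,G_\mu(x)=\sum_{\nu:\ \ell(\nu)\le n}c_{\theta\mu}^{\nu}\,G_\nu(x).$$ Then $c_{\theta\mu}^{\nu}$ is equal to $\beta^{|\nu|-|\mu|-|\theta|}$ times the number of set-valued $\theta$-tableaux $T$ whose column word $r_1r_2\cdots r_l$ (with $l=|T|$) is such that there is a sequence of partitions $$\mu=\rho^{(0)}\stackrel{r_1}{\longrightarrow}\rho^{(1)}\stackrel{r_2}{\longrightarrow}\cdots\stackrel{r_l}{\longrightarrow}\rho^{(l)}=\nu .$$
   Context: Fix a positive integer $n$, a field $\mathbb{F}$ and an indeterminate $\beta$ over $\mathbb{F}$; $[n]=\{1,\dots,n\}$, $x=(x_1,\dots,x_n)$. A partition is identified with its Young diagram (rows counted from the top; box $(i,j)$ lies in row $i$, column $j$); $\ell(\lambda)$ is the number of nonzero parts. A skew diagram is $\theta=\lambda/\mu$ with $\mu\subset\lambda$; every partition is also a skew diagram. $|\theta|$ is the number of boxes. A (semistandard) set-valued $\theta$-tableau $T$ assigns to each box $\alpha\in\theta$ a non-empty set $T(\alpha)\subset[n]$ such that if $\alpha$ is immediately to the left of $\alpha'$ then $\max T(\alpha)\le\min T(\alpha')$, and if $\alpha$ is immediately above $\alpha'$ then $\max T(\alpha)<\min T(\alpha')$. $|T|=\sum_\alpha|T(\alpha)|$ is the number of entries of $T$. The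 ordinary Grothendieck polynomial is $G_\theta(x)=\sum_T\beta^{|T|-|\theta|}\prod_{\alpha\in\theta,\ r\in T(\alpha)}x_r$, summed over all set-valued $\theta$-tableaux $T$. The polynomials $G_\lambda(x)$, $\ell(\lambda)\le n$, form a basis of the symmetric polynomials in $x_1,\dots,x_n$ over $\mathbb{F}(\beta)$, so the $c_{\theta\mu}^\nu$ are well defined. The column word of $T$ is the sequence obtained by reading the entries of $T$ column by column starting from the rightmost column and moving left, from top to bottom within each column, and in decreasing order within each box. $\lambda\stackrel{r}{\longrightarrow}\mu$ means that the partition $\mu$ is obtained from the partition $\lambda$ by adding one box in row $r$. *)

(* Defs.v *)
From HB Require Import structures.
From mathcomp Require Import all_boot all_order all_algebra fraction.
From mathcomp Require Import boolp finmap mpoly.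

Set Implicit Arguments.
Unset Strict Implicit.
Unset Printing Implicit Defensive.

Import GRing.Theory.
Local Open Scope ring_scope.

(* Rows, columns and tableau entries are all numbered from 0: the entry k of
   {1, ..., n} is the element of 'I_n of value k - 1, and row k is row k - 1. *)

Definition is_intpart (s : seq nat) : bool := sorted geq s && (0%N \notin s).

Record intpart := IntPart {
  parts :> seq nat;
  partsP : is_intpart parts }.

HB.instance Definition _ := [isSub for parts].
HB.instance Definition _ := [Choice of intpart by <:].

Definition intpart0 : intpart := @IntPart [::] isT.

Definition diagram (la : intpart) : seq (nat * nat) :=
  [seq (i, j) | i <- iota 0 (size la), j <- iota 0 (nth 0%N la i)].

Record skew_diagram := Skew {
  outer : intpart;
  inner : intpart;
  skewP : {subset diagram inner <= diagram outer} }.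

Definition boxes (th : skew_diagram) : seq (nat * nat) :=
  [seq b <- diagram (outer th) | b \notin diagram (inner th)].

Lemma sub_diagram0 (la : intpart) :
  {subset diagram intpart0 <= diagram la}.
Proof. by []. Qed.

Definition skew_of_part (la : intpart) : skew_diagram := Skew (@sub_diagram0 la).
Coercion skew_of_part : intpart >-> skew_diagram.

Section SetValuedTableaux.
Variables (n : nat) (th : skew_diagram).

Definition filling := {ffun seq_sub (boxes th) -> {set 'I_n}}.

Definition setmax (A : {set 'I_n}) : nat := \max_(a in A) a.
Definition setmin (A : {set 'I_n}) : nat := \big[minn/n]_(a in A) a.

Definition left_of (b b' : nat * nat) : bool := b' == (b.1, b.2.+1).
Definition above (b b' : nat * nat) : bool := b' == (b.1.+1, b.2).

Definition is_svt (T : filling) : bool :=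
  [&& [forall b, T b != set0],
      [forall b, forall b',
        left_of (val b) (val b') ==> (setmax (T b) <= setmin (T b'))%N]
    & [forall b, forall b',
        above (val b) (val b') ==> (setmax (T b) < setmin (T b'))%N]].

Definition num_entries (T : filling) : nat := (\sum_b #|T b|)%N.

Definition entries (T : filling) (i j : nat) : {set 'I_n} :=
  if insub (i, j) is Some b then T b else set0.

(* Positions outside the diagram carry set0 and contribute nothing; [enum]
   lists a set of ordinals increasingly. *)
Definition column_word (T : filling) : seq 'I_n :=
  flatten [seq rev (enum (entries T i j)) |
            j <- rev (iota 0 (head 0%N (outer th))),
            i <- iota 0 (size (outer th))].

End SetValuedTableaux.

(* [incr_nth] pads with zeros when r exceeds the length of la; the result is
   then not (the list of parts of) a partition unless r is the next row. *)
Definition add_box (r : nat) (la mu : intpart) : Prop :=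
  parts mu = incr_nth la r.

Definition partition_chain (mu : intpart) (w : seq nat) (nu : intpart) : Prop :=
  exists rho : nat -> intpart,
    [/\ rho 0%N = mu, rho (size w) = nu &
        forall k, (k < size w)%N -> add_box (nth 0%N w k) (rho k) (rho k.+1)].

Section Grothendieck.
Variables (F : fieldType) (n : nat).

Definition beta : {fraction {poly F}} := tofrac 'X.

(* The exponent is not truncated, as every T b is non-empty. *)
Definition grothendieck (th : skew_diagram) : {mpoly {fraction {poly F}}[n]} :=
  \sum_(T : filling n th | is_svt T)
    beta ^+ (num_entries T - size (boxes th)) *:
      \prod_b \prod_(r in T b) 'X_r.

Definition is_structure_coeffs (th : skew_diagram) (mu : intpart)
    (c : {fsfun intpart -> {fraction {poly F}} with 0}) : Prop :=
  grothendieck th * grothendieck mu =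
    \sum_(nu <- finsupp c | (size nu <= n)%N) c nu *: grothendieck nu.

End Grothendieck.

Definition lr_tableaux (n : nat) (th : skew_diagram) (mu nu : intpart) :
    {set filling n th} :=
  [set T | is_svt T & `[< partition_chain mu (map val (column_word T)) nu >]].

(* Main.v *)
(** Let [a_m] be the antisymmetrization of
    [X^(m + staircase) * \prod_k (1 + beta X_k)^k].  Since [G_theta] is symmetric,
    [G_theta * a_mu] is the sum over all set-valued tableaux [T] of
    [beta^(|T| - |theta|) a_(mu + weight T)].  The tableaux whose column word leaves
    the set of partitions cancel: let [l = j + 1] be the first offending letter, read
    in a cell [d] of column [c].  Splitting off the factor [1 + beta X_l] amounts to
    making the presence of [l] in [d] optional, and the Bender-Knuth involution
    exchanging [j] and [l] in the columns up to [c] then shows that the sum to be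
    antisymmetrized is invariant under the transposition of [X_j] and [X_l].
    For [mu] empty only the superstandard tableau of shape [la] survives, so
    [G_la * a_0 = a_la]; the theorem follows by linear independence of the [a_la]. *)
Require Import Defs.
From HB Require Import structures.
From mathcomp Require Import all_boot all_order all_algebra fraction.
From mathcomp Require Import boolp finmap mpoly.
From mathcomp Require Import all_fingroup zify.

Set Implicit Arguments.
Unset Strict Implicit.
Unset Printing Implicit Defensive.

Import GRing.Theory.

(** * Bender-Knuth involutions on arrays of sets *)

(** The alternants are the numerators of the determinantal formula for Grothendieck polynomials. In
    them the exponents of [1 + beta X_k] grow by exactly one from each index to the next, so a
    single factor [1 + beta X_l] obstructs symmetry in [X_j] and [X_l]. A direct sign-reversing
    involution on non-lattice tableaux meets an obstacle: exchanging [j] and [l] may take [l] out of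
    the cell [d], and with it the violation. Making [l] optional in [d] removes the obstacle, and
    the split factor pays for exactly that. The price is that deleting [l] can leave the box [d]
    empty, which is why the involution is developed for arrays of sets that may have an empty cell
    in the last column [c] it touches. Columns to the right of [c] are read before [d] and stay
    fixed, so that the violation remains the first one. At that moment the two multiplicities,
    counted from [m], are equal; the staircase then leaves a gap of one, which the additional
    variable [X_l] closes. *)

Section Reflection.
Variables (c : nat) (f : pred nat).

(** Meant for a predicate that holds on an interval inside [[0, c]]: [first_in] and [last_in] are
    its endpoints, the second found by searching downwards from [c], and [reflect_in] reverses the
    interval. The values for an empty predicate are junk and never matter. *)
Definition first_in := find f (iota 0 c.+1).
Definition last_in := c - find (fun y => f (c - y)) (iota 0 c.+1).
Definition reflect_in x := first_in + last_in - x.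

Lemma find_iotaP (g : pred nat) m x : g x -> x < m ->
  g (find g (iota 0 m)) /\ find g (iota 0 m) <= x.
Proof.
move=> gx xm.
have hg : has g (iota 0 m) by apply/hasP; exists x; rewrite ?mem_iota.
have := hg; rewrite has_find size_iota => lt_f.
split; first by have := nth_find 0 hg; rewrite nth_iota.
rewrite leqNgt; apply/negP => /(before_find 0).
by rewrite nth_iota // add0n gx.
Qed.

Lemma first_inP x : f x -> x <= c -> f first_in /\ first_in <= x.
Proof. by move=> fx xc; apply: find_iotaP. Qed.

Lemma last_inP x : f x -> x <= c -> [/\ f last_in, x <= last_in & last_in <= c].
Proof.
move=> fx xc.
have [] := @find_iotaP (fun y => f (c - y)) c.+1 (c - x).
- by rewrite subKn.
- lia.
move=> flast le_last; split=> //; rewrite /last_in; lia.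
Qed.

Hypothesis f_le : forall x, f x -> x <= c.
Hypothesis f_conv : forall a d b, f a -> f b -> a <= d <= b -> f d.

Lemma reflect_inP x : f x -> f (reflect_in x).
Proof.
move=> fx; have xc := f_le fx.
have [ff lef] := first_inP fx xc; have [fl lel lec] := last_inP fx xc.
by apply: (f_conv ff fl); rewrite /reflect_in; lia.
Qed.

Lemma reflect_in_bounds x : f x -> first_in <= x <= last_in.
Proof.
move=> fx; have xc := f_le fx.
by have [_ ->] := first_inP fx xc; have [_ ->] := last_inP fx xc.
Qed.

Lemma reflect_inK x : f x -> reflect_in (reflect_in x) = x.
Proof. by move=> /reflect_in_bounds; rewrite /reflect_in; lia. Qed.

Lemma sum_reflect_in N (F : nat -> nat) : (forall x, f x -> x < N) ->
  \sum_(x < N | f x) F (reflect_in x) = \sum_(x < N | f x) F x.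
Proof.
move=> f_lt.
pose rho (x : 'I_N) := if f x then insubd x (reflect_in x) else x.
have rhoE (x : 'I_N) : val (rho x) = if f x then reflect_in x else x.
  by rewrite /rho; case: ifP => // fx; rewrite val_insubd f_lt ?reflect_inP.
have rho_f (x : 'I_N) : f (rho x) = f x.
  by rewrite rhoE; case: ifP => // fx; rewrite reflect_inP.
have rhoK : involutive rho.
  move=> x; apply: val_inj; rewrite rhoE rho_f rhoE.
  by case: ifP => fx; rewrite ?fx ?reflect_inK.
rewrite [RHS](reindex_inj (inv_inj rhoK)).
by apply: eq_big => x /=; rewrite ?rho_f // => fx; rewrite rhoE fx.
Qed.

End Reflection.

Lemma eq_reflect_in c (f g : pred nat) : f =1 g -> reflect_in c f =1 reflect_in c g.
Proof.
move=> fg x; rewrite /reflect_in /first_in /last_in (eq_find fg).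
by rewrite (@eq_find _ (fun y => f (c - y)) (fun y => g (c - y))).
Qed.

(** * The exchange of two adjacent letters in the columns up to [c] *)

Section BenderKnuth.
Variables (n : nat) (j j1 : 'I_n).
Hypothesis j1E : j1 = j.+1 :> nat.
Variable c : nat.
Implicit Types V : nat -> nat -> {set 'I_n}.

Definition in_jj (k : 'I_n) := (k == j) || (k == j1).

Definition supp V i x := (j \in V i x) || (j1 \in V i x).
Definition supp_above V i x := if i is i'.+1 then supp V i' x else false.
(* When j and j+1 occur in two different cells of a column, these cells are
   adjacent and their entries are kept. *)
Definition unpaired V i x :=
  [&& x <= c, supp V i x, ~~ supp_above V i x & ~~ supp V i.+1 x].

(** In a row the unpaired cells form an interval. Reversing it and exchanging the two letters each
    reverse the order, so together they keep the row weakly increasing. A cell containing both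
    letters is moved correctly without separate treatment. *)
Definition bk V i x : {set 'I_n} :=
  [set k | if in_jj k && unpaired V i x
           then tperm j j1 k \in V i (reflect_in c (unpaired V i) x)
           else k \in V i x].

Lemma in_jj_tperm k : in_jj (tperm j j1 k) = in_jj k.
Proof.
rewrite /in_jj; case: tpermP => [->|->|]; rewrite ?eqxx ?orbT //.
Qed.

Lemma in_jjE (k : 'I_n) : in_jj k = (j <= k <= j.+1).
Proof. by rewrite /in_jj -!val_eqE /= j1E; lia. Qed.

Lemma suppP V i x : reflect (exists2 k, in_jj k & k \in V i x) (supp V i x).
Proof.
apply: (iffP orP) => [[]|[k]]; first by exists j; rewrite // /in_jj eqxx.
  by exists j1; rewrite // /in_jj eqxx orbT.
by rewrite /in_jj => /orP[]/eqP->; [left|right].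
Qed.

Lemma free_supp V i x : unpaired V i x -> supp V i x.
Proof. by case/and4P. Qed.

Lemma free_le V i x : unpaired V i x -> x <= c.
Proof. by case/and4P. Qed.

Variables al be : nat -> nat.
Hypothesis al_dec : forall i, al i.+1 <= al i.
Hypothesis be_dec : forall i, be i.+1 <= be i.

(* The last column may have one empty cell: it arises by deleting from a
   tableau the letter j+1 of a box when this is its only entry. *)
Record bk_array V : Prop := BkArray {
  bk_out : forall i x k, k \in V i x -> al i <= x < be i;
  bk_row : forall i x (k l : 'I_n), k \in V i x -> l \in V i x.+1 -> k <= l;
  bk_col : forall i x (k l : 'I_n), k \in V i x -> l \in V i.+1 x -> k < l;
  bk_ne : forall i x, x <= c -> al i <= x < be i -> V i x = set0 ->
             x = c /\ ~~ supp V i.+1 x }.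

Section OneArray.
Variable V : nat -> nat -> {set 'I_n}.
Hypothesis HV : bk_array V.

Let ne i x : x < c -> al i <= x < be i -> exists k, k \in V i x.
Proof.
move=> xc xin; apply/set0Pn/eqP => V0.
by have [] := bk_ne HV (ltnW xc) xin V0; lia.
Qed.

(** The cells strictly between [a] and [b] lie to the left of column [c], so none of them is empty
    and the row condition passes through them. *)
Lemma bk_row_trans i a b (k l : 'I_n) : a < b <= c ->
  k \in V i a -> l \in V i b -> k <= l.
Proof.
elim: b l => [|b IHb] l ab ka lb; first by move: ab; lia.
have [eab|nab] := eqVneq a b; first by apply: (bk_row HV ka); rewrite eab.
have ina := bk_out HV ka; have inb := bk_out HV lb.
have [||m mb] := @ne i b; try lia.
by apply: leq_trans (bk_row HV mb lb); apply: IHb => //; lia.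
Qed.

(** A letter in column [d] is squeezed between letters of columns [a] and [b], hence is [j] or [j1].
    If this cell had a partner above it, the cell above the one in column [b] would be squeezed as
    well and give [b] a partner; a partner below similarly gives one to [a]. Only the cell above [b]
    might be empty, when [b] is the last column, and the second clause of [bk_ne] excludes this. *)
Lemma free_conv i a d b : unpaired V i a -> unpaired V i b -> a <= d <= b -> unpaired V i d.
Proof.
move=> fa fb adb.
have [->//|nad] := eqVneq d a.
have [->//|ndb] := eqVneq d b.
have bc := free_le fb.
have /suppP[ka jka kaV] := free_supp fa.
have /suppP[kb jkb kbV] := free_supp fb.
have ina := bk_out HV kaV; have inb := bk_out HV kbV.
have [||m mV] := @ne i d; try lia.
have am : ka <= m by apply: bk_row_trans kaV mV; lia.
have mb : m <= kb by apply: bk_row_trans mV kbV; lia.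
move: jka jkb; rewrite !in_jjE => jka jkb.
apply/and4P; split; first lia.
- by apply/suppP; exists m; rewrite // in_jjE; lia.
- case: i fa fb kaV kbV ina inb mV => //= i fa fb kaV kbV ina inb mV.
  apply/negP => /suppP[u]; rewrite in_jjE => ju uV.
  have um := bk_col HV uV mV.
  have inu := bk_out HV uV.
  have inb' : al i <= b < be i by have := be_dec i; lia.
  have nsb : ~~ supp V i b by case/and4P: fb.
  have [V0|/set0Pn[v vV]] := eqVneq (V i b) set0.
    have [_] := bk_ne HV bc inb' V0.
    by rewrite (free_supp fb).
  case/negP: nsb; apply/suppP; exists v; rewrite // in_jjE.
  have := bk_col HV vV kbV; have uv : u <= v by apply: bk_row_trans uV vV; lia.
  by lia.
- apply/negP => /suppP[u]; rewrite in_jjE => ju uV.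
  have mu := bk_col HV mV uV.
  have inu := bk_out HV uV.
  have nsa : ~~ supp V i.+1 a by case/and4P: fa.
  have [||v vV] := @ne i.+1 a; first by lia.
    by have := al_dec i; lia.
  case/negP: nsa; apply/suppP; exists v; rewrite // in_jjE.
  have := bk_col HV kaV vV; have vu : v <= u by apply: bk_row_trans vV uV; lia.
  by lia.
Qed.

Let refl i := reflect_in c (unpaired V i).

Lemma free_refl i x : unpaired V i x -> unpaired V i (refl i x).
Proof. exact: (reflect_inP (@free_le V i) (@free_conv i)). Qed.

Lemma supp_bk : supp (bk V) =2 supp V.
Proof.
move=> i x; rewrite /supp !inE /in_jj !eqxx orbT /= tpermL tpermR.
case: ifP => // fx; rewrite orbC.
have := free_supp fx; have := free_supp (free_refl fx).
by rewrite /supp => -> ->.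
Qed.

Lemma free_bk : unpaired (bk V) =2 unpaired V.
Proof.
move=> i x; rewrite /unpaired !supp_bk; congr [&& _, _, ~~ _ & _].
by case: i => //= i; rewrite supp_bk.
Qed.

Lemma bk_nfree i x : ~~ unpaired V i x -> bk V i x = V i x.
Proof. by move=> /negbTE fx; apply/setP => k; rewrite inE fx andbF. Qed.

Lemma bk_nsupp i x : ~~ supp V i x -> bk V i x = V i x.
Proof. by move=> sx; apply: bk_nfree; apply: contra sx; apply: free_supp. Qed.

Lemma bk_njj i x k : ~~ in_jj k -> (k \in bk V i x) = (k \in V i x).
Proof. by move=> /negbTE jk; rewrite inE jk. Qed.

Lemma bkK i x : bk (bk V) i x = V i x.
Proof.
apply/setP => k; rewrite inE free_bk.
have -> : reflect_in c (unpaired (bk V) i) x = refl i x.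
  by apply: eq_reflect_in; apply: free_bk.
case: ifP => [/andP[jk fx]|nfx]; last by rewrite inE nfx.
rewrite inE in_jj_tperm jk (free_refl fx) /= tpermK.
by rewrite /refl (reflect_inK (@free_le V i)).
Qed.

Lemma bk_eq0 i x : (bk V i x == set0) = (V i x == set0).
Proof.
have [fx|/bk_nfree->//] := boolP (unpaired V i x).
have sx := free_supp fx; have sx' : supp (bk V) i x by rewrite supp_bk.
case/suppP: sx => k _ kV; case/suppP: sx' => l _ lV.
by apply/idP/idP => /eqP E; [move: lV|move: kV]; rewrite E inE.
Qed.

(* An entry outside [j, j+1] compares with both of these letters alike. *)
Lemma bk_jj i x k : k \in bk V i x -> in_jj k -> exists2 k', in_jj k' & k' \in V i x.
Proof. by move=> kV jk; apply/suppP; rewrite -supp_bk; apply/suppP; exists k. Qed.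

Lemma bk_njjP i x k : k \in bk V i x -> ~~ in_jj k -> k \in V i x.
Proof. by move=> kV jk; rewrite -bk_njj. Qed.

Lemma bk_colP i x (k l : 'I_n) : k \in bk V i x -> l \in bk V i.+1 x -> k < l.
Proof.
move=> kV lV.
have [jk|njk] := boolP (in_jj k); have [jl|njl] := boolP (in_jj l).
- have sk : supp V i x by rewrite -supp_bk; apply/suppP; exists k.
  have sl : supp V i.+1 x by rewrite -supp_bk; apply/suppP; exists l.
  move: kV lV; rewrite !bk_nfree.
  + exact: bk_col.
  + by apply/negP => /and4P[_ _]; rewrite /= sk.
  + by apply/negP => /and4P[_ _ _]; rewrite sl.
- have [k' jk' k'V] := bk_jj kV jk.
  have := bk_col HV k'V (bk_njjP lV njl).
  by move: jk jk' njl; rewrite !in_jjE; lia.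
- have [l' jl' l'V] := bk_jj lV jl.
  have := bk_col HV (bk_njjP kV njk) l'V.
  by move: jl jl' njk; rewrite !in_jjE; lia.
- exact: bk_col (bk_njjP kV njk) (bk_njjP lV njl).
Qed.

(** Column strictness leaves one possibility for a vertical pair: the upper cell contributes [j],
    the lower one [j1]. *)
Lemma nfree_suppP i x k : x <= c -> in_jj k -> k \in V i x -> ~~ unpaired V i x ->
  (k = j /\ supp V i.+1 x) \/ (k = j1 /\ supp_above V i x).
Proof.
move=> xc jk kV; have sk : supp V i x by apply/suppP; exists k.
rewrite /unpaired xc sk /= negb_and !negbK => /orP[].
  case: i kV sk => //= i kV _ su; right; split=> //; apply: val_inj => /=.
  have /suppP[u ju uV] := su; have := bk_col HV uV kV.
  by rewrite j1E; move: ju jk; rewrite !in_jjE; lia.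
move=> su; left; split=> //; apply: val_inj => /=.
have /suppP[u ju uV] := su; have := bk_col HV kV uV.
by move: ju jk; rewrite !in_jjE; lia.
Qed.

(** Stated for [x < c] only: column [c.+1] is untouched, and its comparison with column [c] is made
    where more is known about column [c]. When just one of two adjacent cells is unpaired, a wrong
    order would force a partner on it too. *)
Lemma bk_rowP i x (k l : 'I_n) : x < c ->
  k \in bk V i x -> l \in bk V i x.+1 -> k <= l.
Proof.
move=> xc kV lV.
have [jk|njk] := boolP (in_jj k); have [jl|njl] := boolP (in_jj l).
- have [fx|nfx] := boolP (unpaired V i x); have [fy|nfy] := boolP (unpaired V i x.+1).
  + move: kV lV; rewrite !inE jk jl fx fy /= => kV lV.
    (* Reflection reverses the two columns and [tperm] the two letters, so the row condition of [V]
       at the reflected columns is the one wanted. *)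
    have lxy : refl i x.+1 < refl i x.
      have := reflect_in_bounds (@free_le V i) fx.
      have := reflect_in_bounds (@free_le V i) fy.
      by rewrite /refl /reflect_in; lia.
    have := bk_row_trans _ lV kV; rewrite lxy (free_le (free_refl fx)) => /(_ isT).
    case/orP: jk => /eqP ->; case/orP: jl => /eqP ->; rewrite ?tpermL ?tpermR ?j1E //.
  + move: lV; rewrite (bk_nfree nfy) => lV.
    case: (nfree_suppP xc jl lV nfy) => [[_ sz]|[-> _]]; last first.
      by move: jk; rewrite in_jjE j1E; lia.
    have [k' jk' k'V] := bk_jj kV jk.
    have /suppP[z jz zV] := sz.
    have inz := bk_out HV zV; have ink := bk_out HV k'V.
    have [||v vV] := @ne i.+1 x; first by lia.
      by have := al_dec i; lia.
    case/and4P: fx => _ _ _ /negP[]; apply/suppP; exists v; rewrite // in_jjE.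
    have := bk_col HV k'V vV; have := bk_row HV vV zV.
    by move: jz jk'; rewrite !in_jjE; lia.
  + move: kV; rewrite (bk_nfree nfx) => kV.
    case: (nfree_suppP (ltnW xc) jk kV nfx) => [[-> _]|[_]].
      by move: jl; rewrite in_jjE; lia.
    case: i kV lV nfx fy => //= i kV lV nfx fy /suppP[u ju uV].
    have [l' jl' l'V] := bk_jj lV jl.
    have inu := bk_out HV uV; have inl := bk_out HV l'V.
    have iny : al i <= x.+1 < be i by have := be_dec i; lia.
    have [V0|/set0Pn[v vV]] := eqVneq (V i x.+1) set0.
      by have [_] := bk_ne HV xc iny V0; rewrite (free_supp fy).
    case/and4P: fy => _ _ /negP[]; apply/suppP; exists v; rewrite // in_jjE.
    have := bk_col HV vV l'V; have := bk_row HV uV vV.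
    by move: ju jl'; rewrite !in_jjE; lia.
  + by move: kV lV; rewrite !bk_nfree //; apply: bk_row.
- have [k' jk' k'V] := bk_jj kV jk.
  have := bk_row HV k'V (bk_njjP lV njl).
  by move: jk jk' njl; rewrite !in_jjE; lia.
- have [l' jl' l'V] := bk_jj lV jl.
  have := bk_row HV (bk_njjP kV njk) l'V.
  by move: jl jl' njk; rewrite !in_jjE; lia.
- exact: bk_row (bk_njjP kV njk) (bk_njjP lV njl).
Qed.

Lemma bk_gt i x : c < x -> bk V i x = V i x.
Proof. by move=> cx; apply: bk_nfree; apply/negP => /free_le; lia. Qed.

(** In one column every paired [j] sits directly above a paired [j1] and conversely, so the two
    indicator sequences agree up to a shift by one row; both ends of the shift contribute 0. *)
Lemma sum_nfree N x : V N x = set0 -> x <= c ->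
  \sum_(i < N) (~~ unpaired V i x && (j \in V i x) : nat) =
  \sum_(i < N) (~~ unpaired V i x && (j1 \in V i x) : nat).
Proof.
move=> VN xc.
have jj : in_jj j by rewrite /in_jj eqxx.
have jj1 : in_jj j1 by rewrite /in_jj eqxx orbT.
have neq : j <> j1 by move=> /(congr1 val); rewrite /= j1E; lia.
pose g i := ~~ unpaired V i x && (j \in V i x).
pose h i := ~~ unpaired V i x && (j1 \in V i x).
have gh i : g i = h i.+1.
  apply/idP/idP => /andP[nf jV]; apply/andP.
    have [[_ su]|[/neq]] := nfree_suppP xc jj jV nf; last by [].
    have sj : supp V i x by apply/suppP; exists j.
    split; first by apply/negP => /and4P[_ _]; rewrite /= sj.
    have /suppP[u ju uV] := su; have := bk_col HV jV uV.
    by move: ju uV => /orP[]/eqP-> //; rewrite ltnn.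
  have [[/esym/neq]|[_ /= su]] := nfree_suppP xc jj1 jV nf; first by [].
  have sj : supp V i.+1 x by apply/suppP; exists j1.
  split; first by apply/negP => /and4P[_ _ _]; rewrite sj.
  have /suppP[u ju uV] := su; have := bk_col HV uV jV.
  by move: ju uV => /orP[]/eqP-> //; rewrite ltnn.
have h0 : h 0 = false.
  apply/negP => /andP[nf jV].
  by have [[/esym/neq]|[]] := nfree_suppP xc jj1 jV nf.
have hN : h N = false by rewrite /h VN inE andbF.
rewrite (eq_bigr (fun i : 'I_N => h i.+1 : nat)); last by move=> i _; rewrite -gh.
have := @big_ord_recl _ 0 addn N (fun i => nat_of_bool (h i)).
rewrite big_ord_recr /= hN h0 addn0 add0n => ->.
by apply: eq_bigr => i _; rewrite /bump.
Qed.

(** Unpaired cells are handled row by row, where the reflection exchanges the counts. Paired cells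
    are unchanged and are handled column by column, where both letters occur equally often. *)
Lemma sum_bk N M k : in_jj k -> (forall i x l, l \in V i x -> i < N /\ x < M) ->
  \sum_(i < N) \sum_(x < M | x <= c) (k \in bk V i x : nat) =
  \sum_(i < N) \sum_(x < M | x <= c) (tperm j j1 k \in V i x : nat).
Proof.
move=> jk bnd.
have splitE (F : nat -> nat -> bool) :
    \sum_(i < N) \sum_(x < M | x <= c) (F i x : nat) =
    \sum_(i < N) \sum_(x < M | unpaired V i x) (F i x : nat) +
    \sum_(x < M | x <= c) \sum_(i < N) (~~ unpaired V i x && F i x : nat).
  rewrite [X in _ = _ + X]exchange_big -big_split /=; apply: eq_bigr => i _.
  rewrite (bigID (fun x : 'I_M => unpaired V i x)) /=; congr (_ + _).
    apply: eq_bigl => x; apply/andP/idP => [[]//|fx]; split=> //.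
    exact: free_le fx.
  by rewrite big_mkcondr /=; apply: eq_bigr => x _; case: unpaired.
rewrite (splitE (fun i x => k \in bk V i x)) (splitE (fun i x => tperm j j1 k \in V i x)).
congr (_ + _).
  apply: eq_bigr => i _.
  rewrite (eq_bigr (fun x : 'I_M => (tperm j j1 k \in V i (refl i x)) : nat)); last first.
    by move=> x fx; rewrite inE jk fx.
  apply: (@sum_reflect_in c (unpaired V i) (@free_le V i) (@free_conv i) M
           (fun x => (tperm j j1 k \in V i x) : nat)) => x fx.
  by have /suppP[l _ /bnd[]] := free_supp fx.
apply: eq_bigr => x xc.
have VN : V N x = set0 by apply/setP => l; rewrite inE; apply/negP => /bnd[]; lia.
transitivity (\sum_(i < N) (~~ unpaired V i x && (k \in V i x) : nat)).
  by apply: eq_bigr => i _; have [//|/bk_nfree->] := boolP (unpaired V i x).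
by case/orP: jk => /eqP->; rewrite ?tpermL ?tpermR sum_nfree.
Qed.

End OneArray.

End BenderKnuth.

Local Open Scope ring_scope.

(** * Deformed alternants *)

Section Alternants.
Variables (n : nat) (K : comNzRingType).
Implicit Types (p q f : {mpoly K[n]}) (m : 'X_{1..n}).

Definition asym p : {mpoly K[n]} := \sum_(s : 'S_n) (-1) ^+ s *: msym s p.

Lemma asym_is_linear : linear asym.
Proof.
move=> a p q; rewrite /asym scaler_sumr -big_split; apply: eq_bigr => s _ /=.
by rewrite linearP scalerDr !scalerA mulrC.
Qed.

HB.instance Definition _ :=
  GRing.isLinear.Build K {mpoly K[n]} {mpoly K[n]} *:%R asym asym_is_linear.

(* The terms of s and of (i j) s cancel, in every characteristic. *)
Lemma asym_tperm0 (i j : 'I_n) p : i != j -> msym (tperm i j) p = p -> asym p = 0.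
Proof.
move=> ij psym; rewrite /asym (bigID (fun s : 'S_n => odd_perm s)) /=.
rewrite (_ : \sum_(s : 'S_n | odd_perm s) _ =
             - \sum_(s : 'S_n | ~~ odd_perm s) (-1) ^+ s *: msym s p) ?addNr //.
rewrite (reindex_inj (mulgI (tperm i j))) -sumrN; apply: eq_big => s.
  by rewrite odd_permM odd_tperm ij addTb.
by rewrite odd_permM odd_tperm ij msymMm psym addTb signrN scaleNr.
Qed.

Lemma asymM_sym f p : f \is symmetric -> asym (f * p) = f * asym p.
Proof.
move=> /issymP fsym; rewrite /asym mulr_sumr; apply: eq_bigr => s _.
by rewrite msymM fsym scalerAr.
Qed.

Lemma symmetric_adjacent f :
  (forall i i1 : 'I_n, i1 = i.+1 :> nat -> msym (tperm i i1) f = f) ->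
  f \is symmetric.
Proof.
move=> fadj.
have ftperm_lt d (i k : 'I_n) : k = (i + d.+1)%N :> nat -> msym (tperm i k) f = f.
  elim: d i k => [|d IHd] i k ik; first by apply: fadj; lia.
  have i1n : (i.+1 < n)%N by have := ltn_ord k; lia.
  pose i1 := Ordinal i1n.
  have fik := IHd i1 k; have fi := fadj i i1.
  have -> : tperm i k = (tperm i1 k ^ tperm i i1)%g.
    rewrite tpermJ tpermR tpermD //.
    - by apply/eqP => /(congr1 val) /=; lia.
    - by apply/eqP => /(congr1 val) /=; lia.
  by rewrite /conjg tpermV !msymMm fi // fik ?fi //= ik; lia.
have ftperm (i k : 'I_n) : msym (tperm i k) f = f.
  have [ik|ki|ik] := ltngtP i k.
  - by apply: (ftperm_lt (k - i.+1)%N); lia.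
  - by rewrite tpermC; apply: (ftperm_lt (i - k.+1)%N); lia.
  - by rewrite (val_inj ik) tperm1 msym1m.
apply/issymP => s; have [ts -> _] := prod_tpermP s.
by elim: ts => [|t ts IHts]; rewrite ?big_nil ?msym1m // big_cons msymMm ftperm.
Qed.

Definition staircase : 'X_{1..n} := [multinom (n.-1 - i)%N | i < n].

Variable b : K.

Definition tail_factor : {mpoly K[n]} := \prod_(i < n) (1 + b *: 'X_i) ^+ i.

Definition alternant m := asym ('X_[m + staircase] * tail_factor).

Lemma msymXU (s : 'S_n) i : msym s 'X_i = 'X_(s i) :> {mpoly K[n]}.
Proof.
rewrite msymX; congr 'X_[_]; apply/mnmP => k; rewrite mnmE !mnm1E.
by rewrite -(inj_eq (@perm_inj _ s)) permKV.
Qed.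

Lemma tail_factor_split (j j1 : 'I_n) : j1 = j.+1 :> nat ->
  exists2 q, tail_factor = (1 + b *: 'X_j1) * q & msym (tperm j j1) q = q.
Proof.
move=> j1E.
have jj1 : j1 != j by apply/eqP => /(congr1 val) /=; lia.
(* Lowering the exponent at [j1] by one makes it equal to the exponent at [j]. *)
exists (\prod_(i < n) (1 + b *: 'X_i) ^+ (i - (i == j1))).
  rewrite /tail_factor (bigD1 j1) //= [in RHS](bigD1 j1) //= mulrA; congr (_ * _).
    by rewrite eqxx j1E subn1 exprS.
  by apply: eq_bigr => i /negbTE->; rewrite subn0.
rewrite rmorph_prod /= [RHS](reindex_inj (@perm_inj _ (tperm j j1))) /=.
apply: eq_bigr => i _.
rewrite rmorphXn rmorphD rmorph1 /= msymZ msymXU; congr (_ ^+ _).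
case: tpermP => [->|->|/eqP nj /eqP nj1] //.
- by rewrite eqxx eq_sym (negbTE jj1) j1E; lia.
- by rewrite eqxx eq_sym (negbTE jj1) j1E; lia.
Qed.

Lemma tail_factor0 : tail_factor@_0%MM = 1.
Proof.
rewrite /tail_factor rmorph_prod /= big1 // => i _.
rewrite rmorphXn rmorphD rmorph1 /= mcoeffZ mcoeffX.
have /negbTE-> : U_(i)%MM != 0%MM :> 'X_{1..n}.
  by apply/eqP => /mnmP /(_ i); rewrite mnm1E eqxx mnm0E.
by rewrite mulr0 addr0 expr1n.
Qed.

Definition dominant m := [forall i : 'I_n, forall k : 'I_n, (i <= k)%N ==> (m k <= m i)%N].

Lemma dominantP m : reflect (forall i k : 'I_n, (i <= k)%N -> (m k <= m i)%N) (dominant m).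
Proof.
apply: (iffP idP) => [/forallP h i k ik|h].
  by have /forallP/(_ k)/implyP := h i; apply.
by apply/forallP => i; apply/forallP => k; apply/implyP/h.
Qed.

Lemma perm_increasing1 (s : 'S_n) :
  (forall i k : 'I_n, (i < k)%N -> (s i < s k)%N) -> s = 1%g.
Proof.
have ge (t : 'S_n) : (forall i k : 'I_n, (i < k)%N -> (t i < t k)%N) ->
    forall i : 'I_n, (i <= t i)%N.
  move=> tinc [i iln]; elim: i iln => [|i IHi] iln //=.
  have iln' := ltnW iln.
  by apply: leq_ltn_trans (IHi iln') (tinc (Ordinal iln') (Ordinal iln) _) => /=.
move=> sinc; have sVinc (i k : 'I_n) : (i < k)%N -> (s^-1%g i < s^-1%g k)%N.
  move=> ik; rewrite ltnNge leq_eqVlt; apply/negP => /orP[/eqP/val_inj/perm_inj ki|].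
    by rewrite ki ltnn in ik.
  by move=> /sinc; rewrite !permKV; lia.
apply/permP => i; rewrite perm1; apply: val_inj; apply/eqP; rewrite eqn_leq /=.
by rewrite (ge _ sinc) andbT; have := ge _ sVinc (s i); rewrite permK.
Qed.

Lemma staircase_strict m (i k : 'I_n) : dominant m -> (i < k)%N ->
  ((m + staircase)%MM k < (m + staircase)%MM i)%N.
Proof.
move=> /dominantP/(_ i k) mdom ik; rewrite !mnmDE !mnmE.
by have := mdom (ltnW ik); have := ltn_ord k; lia.
Qed.

Lemma mcoeff_lowest m m' q : (mdeg m <= mdeg m')%N ->
  ('X_[m'] * q)@_m = (m == m')%:R * q@_0%MM.
Proof.
move=> mm'; have [->|nmm'] := eqVneq m m'.
  by rewrite mulrC mul1r; have := mcoeffMX q m' 0%MM; rewrite addm0.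
rewrite mul0r mcoeffM big1 // => -[k1 k2] /= /eqP mE.
rewrite mcoeffX; case: eqP => [k1E|]; last by rewrite mul0r.
have := congr1 mdeg mE; rewrite -k1E mdegD => degE.
have /eqP : mdeg k2 = 0%N by lia.
by rewrite mdeg_eq0 => /eqP k0; rewrite mE -k1E k0 addm0 eqxx in nmm'.
Qed.

Lemma mdeg_perm (s : 'S_n) m : mdeg [multinom m (s i) | i < n] = mdeg m.
Proof.
rewrite !mdegE [RHS](reindex_inj (@perm_inj _ s)) /=.
by apply: eq_bigr => i _; rewrite mnmE.
Qed.

(** [tail_factor] has constant term 1, so the lowest-degree part is the classical alternant. Both
    shifted exponents are strictly decreasing, and only the identity permutation respects this. *)
Lemma mcoeff_alternant m m' : dominant m -> dominant m' -> (mdeg m <= mdeg m')%N ->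
  (alternant m')@_(m + staircase) = (m == m')%:R.
Proof.
move=> dm dm' mm'.
rewrite /alternant /asym linear_sum /= (bigD1 1%g) //= big1 ?addr0.
  rewrite odd_perm1 expr0 scale1r msym1m mcoeff_lowest ?mdegD ?leq_add2r //.
  by rewrite tail_factor0 mulr1 eqm_add2r.
move=> s s1; rewrite mcoeffZ mcoeff_sym mcoeff_lowest ?mdeg_perm ?mdegD ?leq_add2r //.
case: eqP => [mE|]; last by rewrite mul0r mulr0.
case/eqP: s1; apply: perm_increasing1 => i k ik.
have := staircase_strict dm' ik; rewrite -mE !mnmE.
case: (ltngtP (s i) (s k)) => // [ski|/val_inj/perm_inj ski].
  by have := staircase_strict dm ski; rewrite !mnmE; lia.
by rewrite ski ltnn.
Qed.

(** Triangularity in the degree: the coefficient at [m + staircase] sees only the alternant of [m]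
    and those of smaller degree, and for the latter the coefficients of each exponent sum to 0 by
    induction. Exponents may repeat in [r], since many tableaux share a weight. *)
Lemma alternant_indep (r : seq (K * 'X_{1..n})) :
  (forall x, x \in r -> dominant x.2) ->
  \sum_(x <- r) x.1 *: alternant x.2 = 0 ->
  forall m, \sum_(x <- r | x.2 == m) x.1 = 0.
Proof.
move=> rdom r0 m; have [d] := ubnP (mdeg m); elim: d m => // d IHd m mlt.
have [/dominantP/dominantP dm|ndm] := boolP (dominant m); last first.
  rewrite big_seq_cond big1 // => x /andP[xr /eqP xm].
  by rewrite -xm rdom in ndm.
have := congr1 (mcoeff (m + staircase)) r0; rewrite linear_sum mcoeff0 /=.
pose F (x : K * 'X_{1..n}) := x.1 * (alternant x.2)@_(m + staircase).
rewrite (eq_bigr F); last by move=> x _; rewrite mcoeffZ.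
rewrite (bigID (fun x => (mdeg x.2 < mdeg m)%N)) /=.
rewrite [X in X + _ = _ -> _](_ : _ = 0) ?add0r.
  move=> r0m; rewrite -[RHS]r0m [RHS]big_seq_cond [LHS]big_seq_cond.
  rewrite [RHS]big_mkcond [LHS]big_mkcond.
  apply: eq_bigr => x _; case: ifP => [/andP[xr /eqP xm]|].
    by rewrite xr xm ltnn /= /F xm mcoeff_alternant // eqxx mulr1.
  case xr: (x \in r) => //= /negbT xm; case: ifP => //.
  rewrite -leqNgt => mx; rewrite /F mcoeff_alternant ?rdom // eq_sym (negbTE xm).
  by rewrite mulr0.
pose ms := undup [seq x.2 | x <- r].
transitivity (\sum_(m' <- ms | (mdeg m' < mdeg m)%N) \sum_(x <- r | x.2 == m') F x).
  rewrite (exchange_big_dep (fun x => mdeg x.2 < mdeg m)%N) /=; last first.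
    by move=> m' x mm' /eqP->.
  rewrite [LHS]big_seq_cond [RHS]big_seq_cond; apply: eq_bigr => x /andP[xr xm].
  rewrite (eq_bigl (fun m' => m' == x.2)).
    by rewrite -big_filter filter_pred1_uniq ?undup_uniq ?mem_undup ?map_f // big_seq1.
  by move=> m'; rewrite eq_sym; case: eqP => [->|]; rewrite ?xm ?andbF.
rewrite big1 // => m' mm'.
rewrite (eq_bigr (fun x => x.1 * (alternant m')@_(m + staircase))); last first.
  by move=> x /eqP <-.
by rewrite -mulr_suml IHd ?mul0r //; lia.
Qed.

End Alternants.

(** * Set-valued tableaux and their generating function *)

Lemma nth_intpart_le (la : intpart) i k : (i <= k)%N -> (nth 0 la k <= nth 0 la i)%N.
Proof.
move=> ik; case: (ltnP k (size la)) => [kl|/(nth_default 0%N)->//].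
have /andP[las _] := partsP la.
have := sorted_leq_nth _ _ 0%N las i k; rewrite !inE; apply=> //; last exact: leq_ltn_trans kl.
- by move=> x y z /= yx xz; apply: leq_trans xz yx.
- by move=> x /=.
Qed.

Lemma nth_intpart_gt0 (la : intpart) i : (0 < nth 0 la i)%N = (i < size la)%N.
Proof.
case: (ltnP i (size la)) => [il|/(nth_default 0%N)->//].
have /andP[_] := partsP la; apply: contraNT; rewrite -eqn0Ngt => /eqP<-.
exact: mem_nth.
Qed.

Lemma mem_diagram (la : intpart) i x :
  ((i, x) \in diagram la) = (x < nth 0 la i)%N.
Proof.
apply/allpairsPdep/idP => [[i' [x' [_]]]|xl].
  by rewrite mem_iota add0n => /= xl [-> ->].
exists i, x; split=> //; rewrite mem_iota //= add0n.
by rewrite -nth_intpart_gt0; lia.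
Qed.

Lemma uniq_diagram (la : intpart) : uniq (diagram la).
Proof.
apply: allpairs_uniq_dep; [exact: iota_uniq| by move=> i _; apply: iota_uniq|].
by move=> [i x] [i' x'] _ _ [-> ->].
Qed.

Lemma mem_boxes (th : skew_diagram) i x :
  ((i, x) \in boxes th) = (nth 0 (inner th) i <= x < nth 0 (outer th) i)%N.
Proof. by rewrite mem_filter !mem_diagram -leqNgt. Qed.

Lemma uniq_boxes (th : skew_diagram) : uniq (boxes th).
Proof. exact/filter_uniq/uniq_diagram. Qed.

(** The Bender-Knuth map is known to be an involution only on fillings that satisfy the array
    conditions, so nothing is asked of [h] outside [P]. *)
Lemma reindex_partial_involution (V : nmodType) (I : finType) (P : pred I) (h : I -> I)
    (F : I -> V) :
  (forall i, P i -> P (h i)) -> (forall i, P i -> h (h i) = i) ->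
  \sum_(i | P i) F i = \sum_(i | P i) F (h i).
Proof.
move=> hP hK; rewrite (reindex_onto h h hK); apply: eq_bigl => i.
apply/andP/idP => [[Phi /eqP<-]|Pi]; first exact: hP.
by rewrite hP // hK.
Qed.

Lemma setmax_le (n : nat) (A : {set 'I_n}) m :
  reflect (forall k, k \in A -> (k <= m)%N) (setmax A <= m)%N.
Proof. by apply: (iffP (bigmax_leqP _ _ _)). Qed.

Lemma le_setmin (n : nat) (A : {set 'I_n}) m : (m <= n)%N ->
  reflect (forall k, k \in A -> (m <= k)%N) (m <= setmin A)%N.
Proof.
move=> mn; rewrite /setmin; apply: (iffP idP) => [|h]; last first.
  by elim/big_ind: _ => // x y; rewrite leq_min => -> ->.
move=> + k kA; have := mem_index_enum k; elim: (index_enum _) => // l s IHs.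
rewrite big_cons inE => /predU1P[<-|/IHs{}IHs]; first by rewrite kA leq_min => /andP[].
by case: ifP => // _; rewrite leq_min => /andP[_ /IHs].
Qed.

Section Filling.
Variables (n : nat) (th : skew_diagram).
Implicit Types (T : filling n th) (V : nat -> nat -> {set 'I_n}).

Let al i := nth 0%N (inner th) i.
Let be i := nth 0%N (outer th) i.
Let R := size (outer th).
Let M := head 0%N (outer th).

Lemma boxes_bound i x : (i, x) \in boxes th -> (i < R)%N /\ (x < M)%N.
Proof.
rewrite mem_boxes => /andP[_ xb]; split; first by rewrite /R -nth_intpart_gt0; lia.
by rewrite /M -nth0; apply: leq_trans xb _; apply: nth_intpart_le.
Qed.

Lemma entries_box T (b : seq_sub (boxes th)) : entries T (val b).1 (val b).2 = T b.
Proof.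
rewrite /entries -surjective_pairing insubT ?(valP b) // => bP.
by congr (T _); apply: val_inj.
Qed.

Lemma entriesN T i x : (i, x) \notin boxes th -> entries T i x = set0.
Proof. by move=> nb; rewrite /entries insubN. Qed.

Lemma entries_in T i x k : k \in entries T i x -> (i, x) \in boxes th.
Proof. by apply: contraLR => /entriesN->; rewrite inE. Qed.

Lemma entries_in_shape T i x k : k \in entries T i x -> (al i <= x < be i)%N.
Proof. by move=> /entries_in; rewrite mem_boxes. Qed.

Definition filling_of V : filling n th := [ffun b => V (val b).1 (val b).2].

Lemma entries_filling_of V i x :
  ((i, x) \notin boxes th -> V i x = set0) -> entries (filling_of V) i x = V i x.
Proof.
have [bx _|nb ->//] := boolP ((i, x) \in boxes th); last exact: entriesN.
by have := entries_box (filling_of V) (SeqSub bx); rewrite ffunE.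
Qed.

Lemma filling_ext T T' : (forall i x, entries T i x = entries T' i x) -> T = T'.
Proof. by move=> TT; apply/ffunP => b; rewrite -!entries_box TT. Qed.

Lemma svtP T : reflect
  [/\ forall i x (k l : 'I_n), k \in entries T i x -> l \in entries T i x.+1 -> (k <= l)%N,
      forall i x (k l : 'I_n), k \in entries T i x -> l \in entries T i.+1 x -> (k < l)%N
    & forall i x, (i, x) \in boxes th -> exists k, k \in entries T i x]
  (is_svt T).
Proof.
apply: (iffP and3P) => [[ne row col]|[row col ne]].
  split.
  - move=> i x k l kT lT.
    move/forallP/(_ (SeqSub (entries_in kT)))/forallP/(_ (SeqSub (entries_in lT))): row.
    rewrite /left_of eqxx -!entries_box /= => /setmax_le/(_ _ kT).
    by move/le_setmin; apply=> //; apply: ltnW.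
  - move=> i x k l kT lT.
    move/forallP/(_ (SeqSub (entries_in kT)))/forallP/(_ (SeqSub (entries_in lT))): col.
    rewrite /above eqxx -!entries_box /= => mm.
    have /setmax_le/(_ _ kT) km : (setmax (entries T i x) <= setmax (entries T i x))%N by [].
    have : (k < setmin (entries T i.+1 x))%N by exact: leq_ltn_trans mm.
    by move/le_setmin; apply.
  - move=> i x bx; apply/set0Pn.
    by move/forallP/(_ (SeqSub bx)): ne; rewrite -entries_box.
split.
- by apply/forallP => b; rewrite -entries_box; apply/set0Pn/ne; rewrite -surjective_pairing (valP b).
- apply/forallP => b; apply/forallP => b'; apply/implyP => /eqP bb'.
  apply/setmax_le => k kb; apply/le_setmin; first exact: ltnW.
  move=> l lb; apply: (row (val b).1 (val b).2); first by rewrite entries_box.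
  by rewrite -[(val b).1]/((val b).1, (val b).2.+1).1 -[(val b).2.+1]/((val b).1, (val b).2.+1).2 -bb' entries_box.
- apply/forallP => b; apply/forallP => b'; apply/implyP => /eqP bb'.
  have lb' l : l \in T b' -> l \in entries T (val b).1.+1 (val b).2.
    by rewrite -[(val b).1.+1]/((val b).1.+1, (val b).2).1 -[(val b).2]/((val b).1.+1, (val b).2).2 -bb' entries_box.
  have [k0 k0b] : exists k, k \in T b.
    by rewrite -entries_box; apply: ne; rewrite -surjective_pairing (valP b).
  have max_lt m : (k0 < m)%N -> (forall k, k \in T b -> (k < m)%N) -> (setmax (T b) < m)%N.
    move=> km h; have : (setmax (T b) <= m.-1)%N by apply/setmax_le => k /h; lia.
    by lia.
  apply/le_setmin => [|l /lb' lb]; first by apply: max_lt => *; apply: ltn_ord.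
  by apply: max_lt => [|k kb]; apply: col lb; rewrite entries_box.
Qed.


Definition weight T : 'X_{1..n} := [multinom (\sum_b (k \in T b : nat))%N | k < n].

Lemma mdeg_weight T : mdeg (weight T) = num_entries T.
Proof.
rewrite mdegE /num_entries; rewrite (eq_bigr _ (fun k _ => mnmE _ k)).
rewrite exchange_big /=; apply: eq_bigr => b _.
by rewrite -sum1_card [RHS]big_mkcond; apply: eq_bigr => k _; case: (_ \in _).
Qed.

Lemma num_entries_ge T : is_svt T -> (size (boxes th) <= num_entries T)%N.
Proof.
case/and3P => /forallP ne _ _.
rewrite -(card_seq_sub (uniq_boxes th)) -sum1_card; apply: leq_sum => b _.
by rewrite card_gt0.
Qed.

(** The whole bounding rectangle in reading order: its prefixes match prefixes of the column word,
    and positions outside the diagram contribute empty sets. *)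
Definition cells : seq (nat * nat) :=
  [seq (i, x) | x <- rev (iota 0 M), i <- iota 0 R].

Lemma mem_cells i x : ((i, x) \in cells) = (i < R)%N && (x < M)%N.
Proof.
apply/allpairsP/andP => [[[x' i']]|[iR xM]] /=.
  by rewrite mem_rev !mem_iota /= => -[xM iR [-> ->]].
by exists (x, i); rewrite mem_rev !mem_iota.
Qed.

Lemma uniq_cells : uniq cells.
Proof.
apply: allpairs_uniq; rewrite ?rev_uniq ?iota_uniq //.
by move=> [x i] [x' i'] _ _ [-> ->].
Qed.

Lemma weightE T k : weight T k = (\sum_(b <- cells) (k \in entries T b.1 b.2 : nat))%N.
Proof.
rewrite mnmE (bigID (fun b => b \in boxes th)) /= [X in _ = (_ + X)%N]big1 ?addn0; last first.
  by move=> [i x] nb; rewrite entriesN ?inE.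
rewrite -[RHS]big_filter [RHS](perm_big (boxes th)); last first.
  apply: uniq_perm => [||[i x]]; [by apply/filter_uniq; exact: uniq_cells|exact: uniq_boxes|].
  rewrite mem_filter mem_cells; case: (boolP ((i, x) \in boxes th)) => //.
  by move=> /boxes_bound[-> ->].
rewrite -[in RHS](val_seq_sub_enum (uniq_boxes th)) big_map.
rewrite -[LHS]big_enum /= (perm_big (seq_sub_enum (boxes th))).
  by apply: eq_bigr => b _; rewrite -entries_box.
apply: uniq_perm => [||b]; [exact: enum_uniq|exact: undup_uniq|].
by rewrite mem_enum mem_seq_sub_enum.
Qed.

Lemma sum_cells (P : pred nat) (F : nat -> nat -> nat) :
  (\sum_(b <- cells | P b.2) F b.1 b.2 = \sum_(i < R) \sum_(x < M | P x) F i x)%N.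
Proof.
rewrite big_mkcond /cells big_allpairs_dep /= (perm_big (iota 0 M)); last by rewrite perm_rev.
rewrite -[in LHS](subn0 M) big_mkord exchange_big /= -[in LHS](subn0 R) big_mkord.
by apply: eq_bigr => i _; rewrite [RHS]big_mkcond.
Qed.

Variable K : comNzRingType.
Variable b : K.

Definition groth : {mpoly K[n]} :=
  \sum_(T : filling n th | is_svt T)
    b ^+ (num_entries T - size (boxes th)) *: 'X_[weight T].

(** A tableau has no empty box, so the condition on empty cells holds vacuously and the cut [c] is
    arbitrary. *)
Lemma svt_bk_array (j j1 : 'I_n) c T : is_svt T -> bk_array j j1 c al be (entries T).
Proof.
move=> /svtP[row col ne]; split=> //.
- exact: entries_in_shape.
- by move=> i x _ ix /eqP; rewrite -mem_boxes in ix; have [k kT] := ne _ _ ix; move/eqP=> E; rewrite E inE in kT.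
Qed.

Lemma weight_split c T k : weight T k =
  (\sum_(b <- cells | (b.2 <= c)%N) (k \in entries T b.1 b.2) +
   \sum_(b <- cells | (c < b.2)%N) (k \in entries T b.1 b.2))%N.
Proof.
rewrite weightE (bigID (fun b => b.2 <= c)%N) /=; congr (_ + _)%N.
by apply: eq_bigl => d; rewrite ltnNge.
Qed.

Section BenderKnuthFilling.
Variables (j j1 : 'I_n) (c : nat).
Hypothesis j1E : j1 = j.+1 :> nat.

Let al_dec i := nth_intpart_le (inner th) (leqnSn i).
Let be_dec i := nth_intpart_le (outer th) (leqnSn i).

Definition bk_filling T := filling_of (bk j j1 c (entries T)).

Lemma entries_bk T i x : entries (bk_filling T) i x = bk j j1 c (entries T) i x.
Proof.
rewrite entries_filling_of // => nb.
by rewrite bk_nsupp ?entriesN // /supp entriesN // !inE.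
Qed.

Lemma bk_ext V V' : V =2 V' -> bk j j1 c V =2 bk j j1 c V'.
Proof.
move=> VV' i x; have suppE i' : supp j j1 V i' =1 supp j j1 V' i'.
  by move=> x'; rewrite /supp VV'.
have freeE : unpaired j j1 c V i =1 unpaired j j1 c V' i.
  by move=> x'; rewrite /unpaired !suppE; case: i => //= i; rewrite suppE.
by apply/setP => k; rewrite !inE freeE !VV' (eq_reflect_in c freeE).
Qed.

Lemma bk_fillingK T : bk_array j j1 c al be (entries T) -> bk_filling (bk_filling T) = T.
Proof.
move=> HT; apply: filling_ext => i x.
by rewrite entries_bk (bk_ext (entries_bk T)) (bkK j1E al_dec be_dec HT).
Qed.

Lemma weight_bk_njj T k : ~~ in_jj j j1 k -> weight (bk_filling T) k = weight T k.
Proof.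
by move=> jk; rewrite !weightE; apply: eq_bigr => d _; rewrite entries_bk bk_njj.
Qed.

Lemma weight_bk T k : bk_array j j1 c al be (entries T) -> in_jj j j1 k ->
  weight (bk_filling T) k =
  (\sum_(b <- cells | (b.2 <= c)%N) (tperm j j1 k \in entries T b.1 b.2) +
   \sum_(b <- cells | (c < b.2)%N) (k \in entries T b.1 b.2))%N.
Proof.
move=> HT jk; rewrite (weight_split c); congr (_ + _)%N.
  rewrite (sum_cells (fun x => x <= c)%N (fun i x => k \in entries (bk_filling T) i x)).
  rewrite (sum_cells (fun x => x <= c)%N (fun i x => tperm j j1 k \in entries T i x)).
  rewrite -(sum_bk j1E al_dec be_dec HT jk); last first.
    by move=> i x l /entries_in/boxes_bound.
  by apply: eq_bigr => i _; apply: eq_bigr => x _; rewrite entries_bk.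
by apply: eq_bigr => d cd; rewrite entries_bk bk_gt.
Qed.

End BenderKnuthFilling.

(** The cut [M] lies beyond every column, so no fixed column has to be compared with an exchanged
    one. *)
Lemma bk_svt (j j1 : 'I_n) T : j1 = j.+1 :> nat -> is_svt T -> is_svt (bk_filling j j1 M T).
Proof.
move=> j1E Tsvt; have HT := svt_bk_array j j1 M Tsvt.
have al_dec i := nth_intpart_le (inner th) (leqnSn i).
have be_dec i := nth_intpart_le (outer th) (leqnSn i).
apply/svtP; split=> [i x k l|i x k l|i x bx]; rewrite !entries_bk.
- have [xM|Mx] := ltnP x M; first exact: (bk_rowP j1E al_dec be_dec HT).
  rewrite [bk _ _ _ _ _ x.+1]bk_gt // => _ /entries_in/boxes_bound[_]; lia.
- exact: (bk_colP j1E al_dec be_dec HT).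
- apply/set0Pn; rewrite (bk_eq0 j1E al_dec be_dec HT).
  by apply/set0Pn; have /svtP[_ _] := Tsvt; apply.
Qed.

Lemma mdeg_tperm (s : 'S_n) (m m' : 'X_{1..n}) :
  (forall k, m k = m' (s k)) -> mdeg m = mdeg m'.
Proof.
by move=> mm'; rewrite !mdegE [RHS](reindex_inj (@perm_inj _ s)); apply: eq_bigr.
Qed.

Lemma groth_tperm (j j1 : 'I_n) : j1 = j.+1 :> nat -> msym (tperm j j1) groth = groth.
Proof.
move=> j1E; rewrite /groth linear_sum /=.
rewrite [RHS](reindex_partial_involution (h := bk_filling j j1 M)); last 2 first.
- by move=> T; apply: bk_svt.
- by move=> T Tsvt; apply: bk_fillingK => //; apply: svt_bk_array.
apply: eq_bigr => T Tsvt; rewrite msymZ msymX tpermV.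
have wE k : weight (bk_filling j j1 M T) k = weight T (tperm j j1 k).
  have [jk|njk] := boolP (in_jj j j1 k); last first.
    rewrite weight_bk_njj // tpermD //; move: njk; rewrite /in_jj negb_or.
      by case/andP => nj _; rewrite eq_sym.
    by case/andP => _ nj; rewrite eq_sym.
  have no_right l : (\sum_(b <- cells | (M < b.2)%N) (l \in entries T b.1 b.2) = 0)%N.
    rewrite big1 // => d Md; apply/eqP; rewrite eqb0.
    by apply/negP => /entries_in/boxes_bound[_]; lia.
  by rewrite weight_bk ?(weight_split M) ?no_right //; apply: svt_bk_array.
rewrite -!mdeg_weight (mdeg_tperm wE); congr (_ *: 'X_[_]).
by apply/mnmP => k; rewrite mnmE wE.
Qed.

Lemma groth_sym : groth \is symmetric.
Proof. by apply: symmetric_adjacent => i i1; apply: groth_tperm. Qed.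

End Filling.

(** * Reading order and lattice tableaux *)

Section ReadingOrder.
Variables (n : nat) (th : skew_diagram).
Implicit Types (T : filling n th).
Notation cells := (cells th).

Definition read_before (d d' : nat * nat) :=
  (d'.2 < d.2)%N || (d.2 == d'.2) && (d.1 < d'.1)%N.

Lemma pairwise_cells : pairwise read_before cells.
Proof.
rewrite /cells; have : pairwise (fun x y => y < x)%N (rev (iota 0 (head 0%N (outer th)))).
  rewrite -sorted_pairwise ?rev_sorted ?iota_ltn_sorted //.
  by move=> x y z yx zy; apply: ltn_trans zy yx.
have : pairwise ltn (iota 0 (size (outer th))).
  by have := iota_ltn_sorted 0 (size (outer th)); rewrite sorted_pairwise //; apply: ltn_trans.
elim: (rev _) => //= x s IHs Hi /andP[xs Hs].
rewrite pairwise_cat IHs // andbT; apply/andP; split.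
  apply/allrelP => d d' /mapP[i _ ->] /allpairsP[[x' i'] [/= x's _ ->]].
  by rewrite /read_before /= (allP xs).
rewrite pairwise_map; apply: sub_pairwise Hi => i i' ii' /=.
by rewrite /read_before /= eqxx [(i < i')%N]ii' orbT.
Qed.

Notation cell k := (nth (0%N, 0%N) cells k).

Lemma cell_before k k' : (k < k')%N -> (k' < size cells)%N -> read_before (cell k) (cell k').
Proof.
move=> kk' k's; have /(pairwiseP (0%N, 0%N)) := pairwise_cells; apply=> //.
exact: ltn_trans k's.
Qed.

Lemma mem_take_cells k d : (k < size cells)%N -> d \in take k cells -> read_before d (cell k).
Proof.
move=> ks /(nthP (0%N, 0%N))[k']; rewrite size_take ks => k'k <-.
by rewrite nth_take //; apply: cell_before.
Qed.

Lemma mem_drop_cells k d : (k < size cells)%N -> d \in drop k cells ->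
  d = cell k \/ read_before (cell k) d.
Proof.
move=> ks; rewrite (drop_nth (0%N, 0%N) ks) inE => /predU1P[->|]; first by left.
move=> /(nthP (0%N, 0%N))[k']; rewrite size_drop nth_drop => k'k <-; right.
by apply: cell_before; rewrite ?leq_addr -?ltn_subRL.
Qed.

Definition read_count T (l : 'I_n) k : nat :=
  \sum_(d <- take k cells) (l \in entries T d.1 d.2).

Lemma read_count0 T l : read_count T l 0 = 0%N.
Proof. by rewrite /read_count take0 big_nil. Qed.

Lemma read_countS T l k : (k < size cells)%N ->
  read_count T l k.+1 = (read_count T l k + (l \in entries T (cell k).1 (cell k).2))%N.
Proof.
by move=> ks; rewrite /read_count (take_nth (0%N, 0%N) ks) -cats1 big_cat big_seq1.
Qed.

Lemma read_count_size T l : read_count T l (size cells) = weight T l.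
Proof. by rewrite /read_count take_size weightE. Qed.

Definition opred (l : 'I_n) : 'I_n := Ordinal (leq_ltn_trans (leq_pred l) (ltn_ord l)).

Lemma opredK (l : 'I_n) : (0 < l)%N -> l = (opred l).+1 :> nat.
Proof. by move=> l0; rewrite /= prednK. Qed.

Variable m : 'X_{1..n}.

(* The reading word of T, started from the shape m, leaves the set of
   partitions when it reads the letter l in the k-th cell. *)
Definition violates T k (l : 'I_n) :=
  [&& (0 < l)%N, l \in entries T (cell k).1 (cell k).2
    & (m (opred l) + read_count T (opred l) k <= m l + read_count T l k)%N].

Definition lattice T := ~~ [exists k : 'I_(size cells), exists l, violates T k l].

(** A box is read in decreasing order, so within one cell the larger letter comes earlier. *)
Definition first_violation (p : 'I_(size cells) * 'I_n) T :=
  violates T p.1 p.2 &&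
  [forall k : 'I_(size cells), forall l : 'I_n,
     ((k < p.1) || (k == p.1) && (p.2 < l))%N ==> ~~ violates T k l].

Lemma ex_first_violation T : ~~ lattice T -> exists p, first_violation p T.
Proof.
rewrite negbK => /existsP[k0 /existsP[l0 v0]].
(* As [n - p.2] lies between 1 and [n], this number orders the pairs lexicographically, larger
   letters first within a cell. *)
pose rank (p : 'I_(size cells) * 'I_n) := (p.1 * n + (n - p.2))%N.
case: (@arg_minnP _ (k0, l0) (fun p => violates T p.1 p.2) rank v0) => p vp pmin.
exists p; rewrite /first_violation vp /=; apply/forallP => k; apply/forallP => l.
apply/implyP => klp; apply/negP => /(pmin (k, l)); rewrite /rank /=.
have aux (a c d e N : nat) : (c < N)%N -> (e < N)%N ->
    (d < a)%N || (d == a) && (c < e)%N -> (a * N + (N - c) <= d * N + (N - e))%N -> False.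
  move=> cN eN /orP[da|/andP[/eqP-> ce]]; last by lia.
  by have := leq_mul da (leqnn N); rewrite mulSn; lia.
by move/aux; apply=> //; apply: ltn_ord.
Qed.

Lemma first_violation_uniq T p q : first_violation p T -> first_violation q T -> p = q.
Proof.
case: p q => [k l] [k' l'] /andP[/= v /forallP h] /andP[/= v' /forallP h'].
have /forallP/(_ l')/implyP hp := h k'; have /forallP/(_ l)/implyP hq := h' k.
case: (ltngtP k k') => [kk'|k'k|/val_inj kk'].
- by rewrite kk' v in hq; have := hq isT.
- by rewrite k'k v' in hp; have := hp isT.
rewrite -{}kk' in v' hp hq *; rewrite !eqxx !ltnn v v' /= in hp hq.
case: (ltngtP l l') => [ll'|l'l|/val_inj->//].
- by have := hp ll'.
- by have := hq l'l.
Qed.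

Lemma sum_not_lattice (W : nmodType) (F : filling n th -> W) :
  \sum_(T | is_svt T && ~~ lattice T) F T =
  \sum_p \sum_(T | is_svt T && first_violation p T) F T.
Proof.
rewrite (exchange_big_dep (fun T => is_svt T)) /=; last by move=> ? ? _ /andP[].
rewrite big_mkcondr /=; apply: eq_bigr => T Tsvt.
case: ifP => [/ex_first_violation[p fp]|/negbFE lT].
  rewrite (eq_bigl (pred1 p)) ?big_pred1_eq // => q /=; rewrite Tsvt.
  by apply/idP/eqP => [fq|->//]; apply: first_violation_uniq fq fp.
rewrite big_pred0 // => p; rewrite Tsvt /=; apply/negP => /andP[v _].
by case/negP: lT; apply/existsP; exists p.1; apply/existsP; exists p.2.
Qed.

(* Only violations by the letter l can break the inequality between the
   multiplicities of l-1 and l. *)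
Lemma no_violation_le T (l : 'I_n) k : dominant m -> (0 < l)%N -> (k <= size cells)%N ->
  (forall k', (k' < k)%N -> ~~ violates T k' l) ->
  (m l + read_count T l k <= m (opred l) + read_count T (opred l) k)%N.
Proof.
move=> /dominantP mdom l0; elim: k => [|k IHk] ks nv.
  by rewrite !read_count0 !addn0 mdom //= leq_pred.
rewrite !read_countS //.
have {IHk} IHk := IHk (ltnW ks) (fun k' k'k => nv k' (ltnW k'k)).
have := nv k (ltnSn k); rewrite /violates l0 /=.
case: (l \in _) => /=; last by lia.
by rewrite -ltnNge; lia.
Qed.

(** Without violations adjacent multiplicities stay ordered until the end of the reading. This makes
    the surviving exponents admissible for [alternant_indep]. *)
Lemma lattice_dominant T : dominant m -> lattice T -> dominant (m + weight T)%MM.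
Proof.
move=> mdom latT; apply/dominantP => i k ik.
have [d dE] : exists d, d = (k - i)%N by exists (k - i)%N.
elim: d k ik dE => [|d IHd] k ik dE; first by rewrite (_ : k = i) //; apply: val_inj => /=; lia.
have k0 : (0 < k)%N by lia.
apply: (@leq_trans ((m + weight T)%MM (opred k))); last by apply: IHd => /=; lia.
rewrite !mnmDE -!read_count_size; apply: no_violation_le => // k' k's.
apply: contra latT => v; apply/existsP; exists (Ordinal k's).
by apply/existsP; exists k.
Qed.

End ReadingOrder.

(** * Cancellation of the non-lattice tableaux *)

Section Insertion.
Variables (n : nat) (th : skew_diagram).
Implicit Types (T V : filling n th) (d : seq_sub (boxes th)).

Definition insert_at d (l : 'I_n) V : filling n th :=
  [ffun x => if x == d then l |: V x else V x].

Definition remove_at d (l : 'I_n) V : filling n th :=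
  [ffun x => if x == d then V x :\ l else V x].

Lemma insert_atE d l V i x : entries (insert_at d l V) i x =
  if (i, x) == val d then l |: entries V i x else entries V i x.
Proof.
have [bx|nb] := boolP ((i, x) \in boxes th).
  have := entries_box (insert_at d l V) (SeqSub bx); rewrite /= => ->.
  have /= -> := entries_box V (SeqSub bx).
  by rewrite ffunE -val_eqE.
rewrite !entriesN //; case: eqP => // ix.
by rewrite ix (valP d) in nb.
Qed.

Lemma insert_at_id d l V : l \in V d -> insert_at d l V = V.
Proof.
move=> lV; apply/ffunP => x; rewrite ffunE; case: eqP => // ->.
by apply/setP => k; rewrite inE in_set1; case: eqP => // ->.
Qed.

Lemma remove_atK d l V : l \in V d -> insert_at d l (remove_at d l V) = V.
Proof.
move=> lV; apply/ffunP => x; rewrite !ffunE; case: eqP => // ->.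
by rewrite setD1K.
Qed.

Lemma insert_atK d l V : l \notin V d -> remove_at d l (insert_at d l V) = V.
Proof.
move=> lV; apply/ffunP => x; rewrite !ffunE; case: eqP => // ->.
by rewrite setU1K.
Qed.

Lemma in_remove_at d l V : l \notin remove_at d l V d.
Proof. by rewrite ffunE eqxx setD11. Qed.

Lemma weight_insert_at d l V : l \notin V d ->
  weight (insert_at d l V) = (weight V + U_(l))%MM.
Proof.
move=> lV; apply/mnmP => k; rewrite mnmDE mnm1E !mnmE.
rewrite (bigD1 d) //= [in RHS](bigD1 d) //= ffunE eqxx.
rewrite (eq_bigr (fun x => (k \in V x : nat))); last by move=> x /negbTE xd; rewrite ffunE xd.
rewrite addnAC; congr (_ + _)%N; rewrite in_setU1 eq_sym.
by case: eqP => [<-|]; rewrite ?(negbTE lV) ?addn0.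
Qed.

End Insertion.

Section Cancellation.
Variables (n : nat) (th : skew_diagram) (m : 'X_{1..n}).
Hypothesis mdom : dominant m.
Implicit Types (T V : filling n th).
Notation cells := (cells th).
Notation cell k := (nth (0%N, 0%N) cells k).
Variables (k0 : 'I_(size cells)) (j j1 : 'I_n) (d : seq_sub (boxes th)).
Hypothesis j1E : j1 = j.+1 :> nat.
Hypothesis dE : val d = cell k0.

Let r := (cell k0).1.
Let c := (cell k0).2.
Let al i := nth 0%N (inner th) i.
Let be i := nth 0%N (outer th) i.
Let al_dec i := nth_intpart_le (inner th) (leqnSn i).
Let be_dec i := nth_intpart_le (outer th) (leqnSn i).
Let p := (k0, j1).

Let j1_gt0 : (0 < j1)%N. Proof. by rewrite j1E. Qed.
Let opj1 : opred j1 = j. Proof. by apply: val_inj; rewrite /= j1E. Qed.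

Let dpair : val d = (r, c). Proof. by rewrite dE /r /c -surjective_pairing. Qed.

(* V is, up to the presence of j1 in the box d, a tableau whose first
   violation is p. *)
Definition toggles V := is_svt (insert_at d j1 V) && first_violation m p (insert_at d j1 V).

Let in_jj_j : in_jj j j1 j. Proof. by rewrite /in_jj eqxx. Qed.
Let in_jj_j1 : in_jj j j1 j1. Proof. by rewrite /in_jj eqxx orbT. Qed.

Lemma svt_col_trans T i i' x (k l : 'I_n) : is_svt T -> (i < i')%N ->
  k \in entries T i x -> l \in entries T i' x -> (k < l)%N.
Proof.
move=> /svtP[_ col ne]; elim: i' l => // i' IHi' l ii' kT lT.
have [ei|ni] := eqVneq i i'; first by apply: col kT _; rewrite ei.
have ki := entries_in_shape kT; have li := entries_in_shape lT.
have ai := nth_intpart_le (inner th) (_ : i <= i')%N; have bi := be_dec i'.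
have [u uT] : exists u, u \in entries T i' x.
  by apply: ne; rewrite mem_boxes; move: ai; rewrite /al /be in ki li bi *; lia.
by apply: ltn_trans (col _ _ _ _ uT lT); apply: IHi' => //; lia.
Qed.

Section OneFilling.
Variable V : filling n th.
Hypothesis VP : toggles V.
Let T := insert_at d j1 V.
Let Tsvt : is_svt T. Proof. by case/andP: VP. Qed.
Let Tfirst : first_violation m p T. Proof. by case/andP: VP. Qed.

Let TE i x : entries T i x = if (i, x) == (r, c) then j1 |: entries V i x else entries V i x.
Proof. by rewrite insert_atE dpair. Qed.

Let VT i x k : k \in entries V i x -> k \in entries T i x.
Proof. by rewrite TE; case: eqP => // _ kV; rewrite setU1r. Qed.

Let j1T : j1 \in entries T r c. Proof. by rewrite TE eqxx setU11. Qed.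

Let nviol k l : (k < k0)%N -> ~~ violates m T k l.
Proof.
move=> kk0; case/andP: Tfirst => _ /forallP/(_ (Ordinal (ltn_trans kk0 (ltn_ord k0)))).
by move/forallP/(_ l)/implyP; apply; rewrite /= kk0.
Qed.

Let prefix_le k : (k <= k0)%N ->
  (m j1 + read_count T j1 k <= m j + read_count T j k)%N.
Proof.
move=> kk0; rewrite -opj1; apply: no_violation_le => //.
  exact: leq_trans kk0 (ltnW (ltn_ord k0)).
by move=> k' k'k; apply: nviol; apply: leq_trans k'k kk0.
Qed.

(** The violation gives one inequality, the absence of earlier violations by [j1] the other. The
    balance of [j] and [j1] to the right of column [c] rests on this equality. *)
Let prefix_eq : (m j1 + read_count T j1 k0 = m j + read_count T j k0)%N.
Proof.
apply/eqP; rewrite eqn_leq prefix_le //=.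
by case/andP: Tfirst => /and3P[_ _] /=; rewrite opj1.
Qed.

(** Column strictness leaves only a [j] above [d]. Just before that [j] is read, [j1] is not ahead
    of [j]; then [j] gains one, while the cells above [d] in this column hold no [j1]. So [j] would
    be strictly ahead at [d], against [prefix_eq]. *)
Lemma column_free i k : i != r -> in_jj j j1 k -> k \notin entries T i c.
Proof.
move=> ir jk; apply/negP => kT.
have [ri|ir'|ei] := ltngtP r i.
- have := svt_col_trans Tsvt ri j1T kT; move: jk; rewrite in_jjE //; lia.
- have kj : k = j.
    apply: val_inj => /=; have := svt_col_trans Tsvt ir' kT j1T.
    by move: jk; rewrite in_jjE //; lia.
  rewrite {}kj {jk} in kT.
  have [iR cM] := boxes_bound (entries_in kT).
  have : (i, c) \in cells by rewrite mem_cells iR.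
  move=> /(nthP (0%N, 0%N))[k1 k1s k1E].
  have k10 : (k1 < k0)%N.
    rewrite ltnNge leq_eqVlt; apply/negP => /orP[/eqP E|k01].
      by have := congr1 fst k1E; rewrite -E /= -/r; lia.
    have := cell_before k01 k1s; rewrite k1E /read_before /= -/c -/r.
    by rewrite ltnn eqxx /=; lia.
  have := prefix_le (ltnW k10); have := prefix_eq.
  rewrite /read_count.
  have -> : take k0 cells = take k1 cells ++ take (k0 - k1) (drop k1 cells).
    by rewrite -{1}(subnKC (ltnW k10)) takeD.
  rewrite !big_cat /= (drop_nth (0%N, 0%N) k1s).
  case kE : (k0 - k1)%N => [|e]; first by lia.
  rewrite /= k1E !big_cons /= kT.
  have -> : (\sum_(x <- take e (drop k1.+1 cells)) (j1 \in entries T x.1 x.2) = 0)%N.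
    rewrite big_seq big1 // => -[i' x'] /(nthP (0%N, 0%N))[k2]; rewrite size_take => k2s.
    have k2e : (k2 < e)%N by move: k2s; case: ifP => //; lia.
    rewrite nth_take // nth_drop => k2E.
    have k2k0 : (k1.+1 + k2 < k0)%N by lia.
    have b1 := cell_before k2k0 (ltn_ord k0).
    have b2 := cell_before (_ : k1 < k1.+1 + k2)%N (ltn_trans k2k0 (ltn_ord k0)).
    have {b2} := b2 (leq_addr _ _).
    move: b1; rewrite k2E k1E /read_before /= -/c -/r => b1 b2.
    have -> /= : x' = c by lia.
    apply/eqP; rewrite eqb0; apply/negP => j1i'.
    have := svt_col_trans Tsvt (_ : i' < r)%N j1i' j1T; lia.
  have -> : (j1 \in entries T i c) = false.
    by apply/negP => j1i; have := svt_col_trans Tsvt ir' j1i j1T; rewrite ltnn.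
  by lia.
- by rewrite ei eqxx in ir.
Qed.

Lemma column_nsupp i : i != r -> ~~ supp j j1 (entries V) i c.
Proof.
move=> ir; apply/negP => /suppP[k jk kV].
by have /negP[] := column_free ir jk; apply: VT.
Qed.

(** Only the box [d] may be empty. It lies in column [c], and by [column_free] the cell below it
    holds neither letter, as [bk_ne] demands. *)
Lemma toggles_bk_array : bk_array j j1 c al be (entries V).
Proof.
have [row col ne] := svtP _ Tsvt.
split.
- exact: entries_in_shape.
- by move=> i x k l kV lV; apply: row (VT kV) (VT lV).
- by move=> i x k l kV lV; apply: col (VT kV) (VT lV).
- move=> i x xc ix V0; have [k] : exists k, k \in entries T i x by apply: ne; rewrite mem_boxes.
  rewrite TE; case: eqP => [[-> ->] _|_]; last by rewrite V0 inE.
  by split=> //; apply: column_nsupp; lia.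
Qed.

Let HV := toggles_bk_array.
Let V' := bk_filling j j1 c V.
Let T' := insert_at d j1 V'.

Let T'E i x : entries T' i x =
  if (i, x) == (r, c) then j1 |: bk j j1 c (entries V) i x else bk j j1 c (entries V) i x.
Proof. by rewrite insert_atE dpair entries_bk. Qed.

(** From column [c] on, the exchange can change only the box [d]; as [j1] is put back there, the
    only possible newcomer is [j]. *)
Let T'_right i x k : (c <= x)%N -> k \in entries T' i x ->
  k \in entries T i x \/ k = j /\ (i, x) = (r, c).
Proof.
rewrite leq_eqVlt => /predU1P[<-|cx]; last first.
  rewrite T'E bk_gt //; case: eqP => [[_ E]|_ /VT]; last by left.
  by move: cx; rewrite E ltnn.
rewrite T'E; case: eqP => [[->]|/eqP ir]; last first.
  rewrite bk_nsupp; first by move/VT; left.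
  by apply: column_nsupp; apply: contraNneq ir => ->.
rewrite in_setU1 => /predU1P[->|kV']; first by left.
have [jk|njk] := boolP (in_jj j j1 k); last by left; apply/VT/(bk_njjP kV' njk).
by case/orP: jk => /eqP->; [right|left].
Qed.

Let T'_eq i x : (i, x) != (r, c) -> (c < x)%N || (x == c) ->
  entries T' i x = entries T i x.
Proof.
move=> ir; rewrite T'E TE (negbTE ir) => /orP[cx|/eqP xc]; first by rewrite bk_gt.
rewrite bk_nsupp // xc; apply: column_nsupp; apply: contraNneq ir => ->.
by rewrite xc.
Qed.

(** Across the cut a new [j] in [d] is harmless, being smaller than the [j1] that [T] has there.
    Within the column, the entries above [d] are smaller than [j1] and differ from [j] by
    [column_free]. *)
Lemma toggles_svt : is_svt T'.
Proof.
have [row col ne] := svtP _ Tsvt.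
apply/svtP; split.
- move=> i x k l kT' lT'.
  have [xc|cx] := ltnP x c.
    have kV' : k \in bk j j1 c (entries V) i x.
      by move: kT'; rewrite T'E; case: eqP => // -[_ E]; move: xc; rewrite E ltnn.
    move: lT'; rewrite T'E; case: eqP => [[ir x1]|_]; last exact: (bk_rowP j1E al_dec be_dec HV).
    rewrite in_setU1 => /predU1P[->|]; last exact: (bk_rowP j1E al_dec be_dec HV).
    have [|njk] := boolP (in_jj j j1 k); first by rewrite in_jjE //; lia.
    by apply: row (VT (bk_njjP kV' njk)) _; rewrite ir x1.
  have lT : l \in entries T i x.+1.
    have [//|[_ [_ E]]] := T'_right (leqW cx) lT'.
    by move: cx; rewrite -E ltnn.
  have [kT|[-> [ir xc]]] := T'_right cx kT'; first exact: row kT lT.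
  by rewrite ir xc in lT; have := row _ _ _ _ j1T lT; lia.
- move=> i x k l kT' lT'.
  have [xc|nxc] := eqVneq x c; last first.
    have nrc i' : ((i', x) == (r, c)) = false by apply/negP => /eqP[_ E]; rewrite E eqxx in nxc.
    by move: kT' lT'; rewrite !T'E !nrc; apply: (bk_colP j1E al_dec be_dec HV).
  subst x.
  have [kT|[kj [ir]]] := T'_right (leqnn c) kT'; have [lT|[lj [lr]]] := T'_right (leqnn c) lT'.
  + exact: col kT lT.
  + have kj1 : (k < j1)%N by apply: col kT _; rewrite lr.
    have ir : i != r by lia.
    have := column_free ir in_jj_j; have : k != j by apply: contraNneq (column_free ir in_jj_j) => <-.
    by rewrite lj -val_eqE /=; lia.
  + by rewrite ir in lT; have := col _ _ _ _ j1T lT; rewrite kj; lia.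
  + by lia.
- move=> i x ix; rewrite T'E; case: eqP => [_|/eqP nrc]; first by exists j1; rewrite setU11.
  apply/set0Pn; rewrite (bk_eq0 j1E al_dec be_dec HV).
  by apply/set0Pn; have [k] := ne _ _ ix; rewrite TE (negbTE nrc) => kV; exists k.
Qed.

Let read_count_eq k l : (k <= k0)%N -> read_count T' l k = read_count T l k.
Proof.
move=> kk0; rewrite /read_count big_seq [RHS]big_seq.
apply: eq_bigr => -[i x] ixk; rewrite T'_eq //.
all: have /(mem_take_cells (ltn_ord k0)) : (i, x) \in take k0 cells.
all: try by rewrite -(subnKC kk0) takeD mem_cat ixk.
all: rewrite /read_before /= -/c -/r.
- by move=> h; apply/negP => /eqP[E1 E2]; lia.
- by lia.
Qed.

(** Everything read up to the letter [j1] of [d] agrees in both tableaux: the earlier cells are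
    unchanged, and so are the letters of [d] larger than [j1]. *)
Lemma toggles_first : first_violation m p T'.
Proof.
have viol_eq (k : 'I_(size cells)) (l : 'I_n) : (k < k0)%N || (k == k0) && (j1 <= l)%N ->
    violates m T' k l = violates m T k l.
  move=> kl; have kk0 : (k <= k0)%N by case/orP: kl => [/ltnW//|/andP[/eqP->]].
  rewrite /violates !read_count_eq //; congr [&& _, _ & _].
  have [E|nE] := eqVneq (cell k) (cell k0).
    have kE : k = k0.
      have := nth_uniq (0%N, 0%N) (ltn_ord k) (ltn_ord k0) (uniq_cells th).
      by move=> kk; apply: val_inj; apply/eqP; rewrite -kk; apply/eqP.
    have jl : (j1 <= l)%N by move: kl; rewrite kE ltnn eqxx.
    rewrite E -/r -/c; rewrite T'E TE !eqxx !in_setU1; case: eqP => //= /eqP lj1.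
    by rewrite bk_njj // in_jjE //; move: lj1; rewrite -val_eqE /=; lia.
  rewrite T'_eq //.
  have : (k < k0)%N.
    by rewrite ltn_neqAle kk0 andbT; apply: contraNneq nE => /val_inj->.
  by move=> /cell_before/(_ (ltn_ord k0)); rewrite /read_before -/c -/r; lia.
case/andP: Tfirst => v /forallP h; apply/andP; split.
  by rewrite viol_eq //= eqxx leqnn orbT.
apply/forallP => k; apply/forallP => l; apply/implyP => /= kl.
rewrite viol_eq; last by case/orP: kl => [->//|/andP[-> /ltnW->]]; rewrite orbT.
by have /forallP/(_ l)/implyP := h k; apply.
Qed.

Lemma toggles_bk : toggles V'.
Proof. by apply/andP; split; [exact: toggles_svt|exact: toggles_first]. Qed.

(** The cells read before [d] are those to the right of column [c] and those above [d] in column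
    [c]; the latter contain neither letter. *)
Lemma right_count l : in_jj j j1 l ->
  (\sum_(x <- cells | (c < x.2)%N) (l \in entries V x.1 x.2))%N = read_count T l k0.
Proof.
move=> jl; rewrite -{1}(cat_take_drop k0 cells) big_cat /= [X in (_ + X)%N]big_seq_cond.
rewrite [X in (_ + X)%N]big1 ?addn0; last first.
  move=> x /andP[xd cx]; have [E|] := mem_drop_cells (ltn_ord k0) xd.
    by move: cx; rewrite E ltnn.
  by rewrite /read_before -/c -/r; lia.
rewrite /read_count [RHS]big_seq [LHS]big_seq_cond [RHS]big_mkcond [LHS]big_mkcond.
apply: eq_bigr => -[i x] _ /=; case ixk: ((i, x) \in _) => //=.
have := mem_take_cells (ltn_ord k0) ixk; rewrite /read_before /= -/c -/r => h.
rewrite TE; have -> : ((i, x) == (r, c)) = false by apply/negP => /eqP[E1 E2]; lia.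
case: ifP => // /negbT cx; have xc : x = c by lia.
have ir : i != r by lia.
have /negbTE := column_free ir jl; rewrite TE xc.
by have -> /= : ((i, c) == (r, c)) = false by [apply/negP => /eqP[E]; lia]; move=> ->.
Qed.

(** The columns up to [c] exchange their two counts, and [m] together with the columns further right
    is balanced by [prefix_eq]. The step of one in the staircase is offset by [U_(j1)]. *)
Lemma weight_toggle k :
  (m + staircase n + weight V' + U_(j1))%MM k =
  (m + staircase n + weight V + U_(j1))%MM (tperm j j1 k).
Proof.
have neq : (j1 == j) = false by apply/negP => /eqP E; move: j1E; rewrite E; lia.
(* The bound [i.+1 < s] keeps the truncated subtractions of the staircase exact. *)
have aux (a a' N N' B i s : nat) : (i.+1 < s)%N -> (a' + N' = a + N)%N ->
  (a + (s.-1 - i) + (B + N) + 0 = a' + (s.-1 - i.+1) + (B + N') + 1)%N by clear; lia.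
have wj := weight_split c V j; have wj1 := weight_split c V j1.
have w'j := weight_bk j1E HV in_jj_j; have w'j1 := weight_bk j1E HV in_jj_j1.
rewrite !right_count // tpermL tpermR in wj wj1 w'j w'j1.
have := prefix_eq; have := ltn_ord j1.
rewrite !mnmDE !mnm1E.
case: (tpermP j j1 k) => [->|->|/eqP kj /eqP kj1].
- by rewrite eqxx neq ![staircase n _]mnmE w'j wj1 j1E; apply: aux.
- by rewrite eqxx neq ![staircase n _]mnmE w'j1 wj j1E => jn E; apply/esym/aux.
- by rewrite weight_bk_njj // /in_jj (negbTE kj) (negbTE kj1).
Qed.

Lemma toggle_twice : bk_filling j j1 c V' = V.
Proof. exact: bk_fillingK HV. Qed.

End OneFilling.
End Cancellation.

(** * Expansion of a Grothendieck polynomial times an alternant *)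

Section AlternantExpansion.
Variables (n : nat) (th : skew_diagram) (m : 'X_{1..n}).
Hypothesis mdom : dominant m.
Variables (K : comNzRingType) (b : K).
Notation cells := (cells th).
Notation cell k := (nth (0%N, 0%N) cells k).
Notation size_th := (size (boxes th)).
Implicit Types (T V : filling n th).

Let term T := b ^+ (num_entries T - size_th) *: 'X_[weight T] : {mpoly K[n]}.
Let seed := 'X_[m + staircase n] * tail_factor n b.

Lemma violates_box (k : 'I_(size cells)) l T : violates m T k l -> cell k \in boxes th.
Proof. by case/and3P => _ /entries_in; rewrite -surjective_pairing. Qed.

Section OnePosition.
Variables (k : 'I_(size cells)) (l j : 'I_n) (d : seq_sub (boxes th)).
Hypotheses (lE : l = j.+1 :> nat) (dE : val d = cell k).

Lemma first_violation_in T : first_violation m (k, l) T -> l \in T d.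
Proof. by case/andP => /and3P[_ /= lT _] _; rewrite -entries_box dE. Qed.

(** Each tableau [T] accounts for two fillings: [T] with [l] removed from [d] carries the term 1 of
    the factor, and [T] itself the term [b *: 'X_l]. *)
Lemma sum_toggles :
  \sum_(V | toggles m k l d V)
     b ^+ ((num_entries V).+1 - size_th) *: 'X_[m + staircase n + weight V + U_(l)] =
  (\sum_(T | is_svt T && first_violation m (k, l) T) term T) *
     ('X_[m + staircase n] * (1 + b *: 'X_l)).
Proof.
rewrite (bigID (fun V : filling n th => l \in V d)) /= mulr_suml.
rewrite [X in _ + X](reindex_onto (remove_at d l) (insert_at d l)) /=; last first.
  by move=> V /andP[_]; apply: insert_atK.
rewrite [X in X + _](eq_bigl (fun T => is_svt T && first_violation m (k, l) T)); last first.
  move=> V; apply/andP/andP => [[tV lV]|[Vsvt Vf]].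
    by move/andP: tV; rewrite insert_at_id.
  have lV := first_violation_in Vf.
  by split=> //; rewrite /toggles insert_at_id // Vsvt.
rewrite [X in _ + X](eq_bigl (fun T => is_svt T && first_violation m (k, l) T)); last first.
  move=> T; apply/andP/andP => [[/andP[tT _] /eqP TE]|[Tsvt Tf]].
    by move/andP: tT; rewrite TE.
  have lT := first_violation_in Tf.
  by rewrite /toggles remove_atK // Tsvt Tf in_remove_at eqxx.
rewrite -big_split /=; apply: eq_bigr => T /andP[Tsvt Tf].
have wT : weight T = (weight (remove_at d l T) + U_(l))%MM.
  by rewrite -(weight_insert_at (in_remove_at d l T)) remove_atK ?first_violation_in.
have nT : num_entries T = (num_entries (remove_at d l T)).+1.
  by rewrite -!mdeg_weight wT mdegD mdeg1 addn1.
rewrite -nT -[X in _ + _ *: 'X_[X]]addmA -wT subSn ?num_entries_ge // exprS.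
rewrite /term !mulrDr mulr1 -!scalerAl -!scalerAr !mpolyXD scalerA addrC; congr (_ + _).
  by congr (_ *: _); rewrite mulrC.
by congr (_ *: _); [exact: mulrC|rewrite [RHS]mulrCA !mulrA].
Qed.

Lemma toggles_sum_tperm :
  let S := \sum_(V | toggles m k l d V)
     b ^+ ((num_entries V).+1 - size_th) *: 'X_[m + staircase n + weight V + U_(l)] in
  msym (tperm j l) S = S.
Proof.
rewrite /= linear_sum /=.
rewrite [RHS](reindex_partial_involution (h := bk_filling j l (cell k).2)); last 2 first.
- by move=> V; apply: toggles_bk.
- by move=> V; apply: toggle_twice.
apply: eq_bigr => V tV; rewrite msymZ msymX tpermV.
have wE := weight_toggle mdom lE dE tV.
congr (_ ^+ (_ - _) *: 'X_[_]).
  have := mdeg_tperm wE; rewrite !mdegD mdeg1 !mdeg_weight; lia.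
by apply/mnmP => i; rewrite mnmE wE.
Qed.

End OnePosition.

Lemma asym_first_violation (p : 'I_(size cells) * 'I_n) :
  asym ((\sum_(T | is_svt T && first_violation m p T) term T) * seed) = 0.
Proof.
case: p => k l.
(* The position has to be a box and the letter positive. A tableau with this first violation
   provides both; without one the sum is empty. *)
have [T /andP[_ Tf]|noT] := pickP (fun T : filling n th => is_svt T && first_violation m (k, l) T); last first.
  by rewrite big_pred0 // mul0r linear0.
have /= v : violates m T k l by case/andP: Tf.
have l0 : (0 < l)%N by case/andP: v.
have lE := opredK l0; set j := opred l in lE.
have [q tE qsym] := tail_factor_split b lE.
pose d := SeqSub (violates_box v).
rewrite /seed tE !mulrA -[X in asym (X * q)]mulrA -(@sum_toggles k l d erefl).
apply: (asym_tperm0 (i := j) (j := l)).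
  by rewrite -val_eqE /=; lia.
by rewrite msymM qsym (@toggles_sum_tperm k l j d lE erefl).
Qed.

Theorem groth_mul_alternant :
  groth n th b * alternant b m =
  \sum_(T : filling n th | is_svt T && lattice m T)
     b ^+ (num_entries T - size_th) *: alternant b (m + weight T).
Proof.
rewrite /alternant -(asymM_sym _ (groth_sym n th b)) /groth.
rewrite (bigID (lattice m)) /= mulrDl linearD /= [X in _ + X](_ : _ = 0) ?addr0.
  rewrite mulr_suml linear_sum /=; apply: eq_bigr => T _.
  rewrite -scalerAl linearZ /= mulrA -mpolyXD; congr (_ *: asym ('X_[_] * _)).
  by apply/mnmP => i; rewrite !mnmDE addnCA addnA.
rewrite (sum_not_lattice m term) mulr_suml linear_sum big1 // => p _.
exact: asym_first_violation.
Qed.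

End AlternantExpansion.

(** * Lattice words and chains of partitions *)

Lemma intpart_ext (la mu : intpart) : (forall i, nth 0%N la i = nth 0%N mu i) -> la = mu.
Proof.
move=> lm; apply: val_inj; apply: (@eq_from_nth _ 0%N) => [|i _]; last exact: lm.
apply/eqP; rewrite eqn_leq; apply/andP; split; rewrite leqNgt; apply/negP.
  by rewrite -nth_intpart_gt0 lm nth_default.
by rewrite -nth_intpart_gt0 -lm nth_default.
Qed.

(** The condition also bounds [r] by the number of parts, so [incr_nth] creates no zero part. *)
Lemma is_intpart_incr_nth (mu : intpart) r :
  (r == 0)%N || (nth 0 mu r < nth 0 mu r.-1)%N -> is_intpart (incr_nth mu r).
Proof.
move=> rP; have rs : (r <= size mu)%N.
  case/orP: rP => [/eqP->//|h]; have : (0 < nth 0 mu r.-1)%N by apply: leq_ltn_trans h.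
  by rewrite nth_intpart_gt0; case: (r).
apply/andP; split.
  apply/(sortedP 0%N) => i _; rewrite /= !nth_incr_nth.
  have := nth_intpart_le mu (leqnSn i).
  rewrite /geq; case: (r =P i.+1) rP => [->|_ _] /=; first by case: eqP; lia.
  by case: (r == i); lia.
apply/negP => /(nthP 0%N)[i]; rewrite size_incr_nth nth_incr_nth.
case: (r =P i) => [->|/eqP ri]; rewrite ?add1n // add0n => ir E.
have := nth_intpart_gt0 mu i; rewrite E ltnn => /esym/negbT; rewrite -leqNgt => si.
move: ir; case: (ltnP r (size mu)) => [_|sr]; first by rewrite ltnNge si.
rewrite ltnS => ir.
by case/eqP: ri; apply/eqP; rewrite eqn_leq ir (leq_trans rs si).
Qed.

(** [f] records the current row lengths as a plain function, so that inductions on the word carry no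
    proof that the shapes are partitions. *)
Fixpoint lattice_word (f : nat -> nat) (w : seq nat) : bool :=
  if w is r :: w' then
    ((r == 0)%N || (f r < f r.-1)%N) && lattice_word (fun i => f i + (i == r))%N w'
  else true.

Lemma eq_lattice_word f g w : f =1 g -> lattice_word f w = lattice_word g w.
Proof.
elim: w f g => //= r w IHw f g fg; rewrite !fg; congr (_ && _).
by apply: IHw => i; rewrite fg.
Qed.

Lemma lattice_word_cat f u v : lattice_word f (u ++ v) =
  lattice_word f u && lattice_word (fun i => f i + count_mem i u)%N v.
Proof.
elim: u f => [|r u IHu] f /=; first by apply: eq_lattice_word => i; rewrite addn0.
rewrite IHu andbA; congr (_ && _); apply: eq_lattice_word => i.
by rewrite addnA eq_sym.
Qed.

(** Reading [r] alters row [r] only, while a later letter [i < r] is tested on the rows [i] and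
    [i.-1]. All letters of a box are thus tested against the shape before the box, which explains
    the form of [violates]. *)
Lemma lattice_word_decreasing f w : sorted gtn w ->
  lattice_word f w = all (fun r => (r == 0)%N || (f r < f r.-1)%N) w.
Proof.
elim: w f => //= r w IHw f; rewrite (path_sortedE (rev_trans ltn_trans)) => /andP[rw sw].
rewrite IHw //; congr (_ && _); apply: eq_in_all => i /(allP rw) /= ir.
by rewrite (ltn_eqF ir) (ltn_eqF (leq_ltn_trans (leq_pred i) ir)) !addn0.
Qed.

Lemma lattice_word_flatten (A : Type) (x0 : A) f (g : A -> seq nat) (s : seq A) :
  lattice_word f (flatten [seq g x | x <- s]) <->
  forall k, (k < size s)%N ->
    lattice_word (fun i => f i + count_mem i (flatten [seq g x | x <- take k s]))%N
                 (g (nth x0 s k)).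
Proof.
elim/last_ind: s => [|s x IHs] //.
rewrite map_rcons flatten_rcons lattice_word_cat; split=> [/andP[/IHs ws wx] k|ws].
  rewrite size_rcons ltnS leq_eqVlt nth_rcons => /predU1P[->|ks].
    by rewrite ltnn eqxx -cats1 take_size_cat.
  by rewrite ks -cats1 takel_cat ?ws // ltnW.
apply/andP; split.
  apply/IHs => k ks; have := ws k; rewrite size_rcons nth_rcons ks -cats1 takel_cat ?(ltnW ks) //.
  by apply; apply: ltnW.
by have := ws (size s); rewrite size_rcons nth_rcons ltnn eqxx -cats1 take_size_cat //; apply.
Qed.

Lemma partition_chainP (mu nu : intpart) (w : seq nat) :
  partition_chain mu w nu <->
  lattice_word (nth 0%N mu) w /\ forall i, nth 0%N nu i = (nth 0 mu i + count_mem i w)%N.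
Proof.
elim: w mu => [|r w IHw] mu.
  split=> [[rho [<- <- _]]|[_ E]]; first by split=> // i; rewrite addn0.
  by exists (fun=> mu); split=> //; apply/esym/intpart_ext => i; rewrite E addn0.
split=> [[rho [rho0 rhow step]]|[/= /andP[rP wP] E]].
  have r1 := step 0%N isT; rewrite /add_box /= rho0 in r1.
  have [] : partition_chain (rho 1%N) w nu.
    by exists (fun k => rho k.+1); split=> // k kw; apply: (step k.+1).
  have r1E i : nth 0%N (rho 1%N) i = (nth 0 mu i + (i == r))%N.
    by rewrite r1 nth_incr_nth addnC eq_sym.
  move=> rho1 [rho10 rho1w step1].
  have /IHw[wP nuE] : partition_chain (rho 1%N) w nu by exists rho1.
  split=> [/=|i]; last by rewrite nuE r1E /= addnA eq_sym.
  apply/andP; split; last by rewrite -(eq_lattice_word _ r1E).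
  case: eqP => //= r0; have := nth_intpart_le (rho 1%N) (leq_pred r).
  by rewrite !r1E eqxx (_ : (r.-1 == r) = false) ?addn0 ?addn1 //; lia.
pose mu' := IntPart (is_intpart_incr_nth rP).
have mu'E i : nth 0%N mu' i = (nth 0 mu i + (i == r))%N.
  by rewrite /= nth_incr_nth addnC eq_sym.
have /IHw[rho [rho0 rhow step]] : lattice_word (nth 0%N mu') w /\
    forall i, nth 0%N nu i = (nth 0 mu' i + count_mem i w)%N.
  split; first by rewrite (eq_lattice_word _ mu'E).
  by move=> i; rewrite E mu'E /= addnA eq_sym.
exists (fun k => if k is k'.+1 then rho k' else mu); split=> // -[|k] kw.
  by rewrite /add_box /= rho0.
exact: step.
Qed.

Definition mnm_of_part n (la : intpart) : 'X_{1..n} := [multinom nth 0%N la i | i < n].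

Lemma mdeg_mnm_of_part n (la : intpart) : (size la <= n)%N ->
  mdeg (mnm_of_part n la) = sumn la.
Proof.
move=> sla; rewrite mdegE (eq_bigr _ (fun i _ => mnmE _ i)) sumnE (big_nth 0%N) big_mkord.
rewrite (big_ord_widen n (fun i => nth 0%N la i) sla) [RHS]big_mkcond.
by apply: eq_bigr => i _; case: ltnP => // /(nth_default 0%N).
Qed.

Lemma mnm_of_part_inj n (la mu : intpart) : (size la <= n)%N -> (size mu <= n)%N ->
  mnm_of_part n la = mnm_of_part n mu -> la = mu.
Proof.
move=> sla smu /mnmP E; apply: intpart_ext => i.
have [iln|nli] := ltnP i n; first by have := E (Ordinal iln); rewrite !mnmE.
by rewrite !nth_default //; lia.
Qed.

Lemma dominant_mnm_of_part n (la : intpart) : dominant (mnm_of_part n la).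
Proof. by apply/dominantP => i k ik; rewrite !mnmE nth_intpart_le. Qed.

(** * From column words to the lattice condition *)

Section LatticeTableaux.
Variables (n : nat) (th : skew_diagram) (mu nu : intpart).
Implicit Types T : filling n th.
Notation cells := (cells th).

Definition letters T (d : nat * nat) : seq nat :=
  map val (rev (enum (entries T d.1 d.2))).

Lemma val_column_word T : map val (column_word T) = flatten [seq letters T d | d <- cells].
Proof.
rewrite /column_word map_flatten /cells map_allpairs map_allpairs.
by congr flatten; apply: eq_in_allpairs.
Qed.

Lemma mem_letters T d (l : 'I_n) : (val l \in letters T d) = (l \in entries T d.1 d.2).
Proof. by rewrite mem_map ?mem_rev ?mem_enum //; apply: val_inj. Qed.

Lemma letters_decreasing T d : sorted gtn (letters T d).
Proof.
rewrite /letters map_rev rev_sorted -[sorted _ _]/(sorted ltn _).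
apply: (@subseq_sorted _ _ (@ltn_trans) _ (map val (enum 'I_n))).
  apply: map_subseq; rewrite (_ : enum _ = filter (mem (entries T d.1 d.2)) (enum 'I_n)).
    exact: filter_subseq.
  by rewrite enumT /enum_mem.
by rewrite val_enum_ord iota_ltn_sorted.
Qed.

Lemma count_letters T d (l : 'I_n) :
  count_mem (val l) (letters T d) = (l \in entries T d.1 d.2).
Proof.
rewrite count_uniq_mem ?mem_letters //.
by rewrite map_inj_uniq ?rev_uniq ?enum_uniq //; apply: val_inj.
Qed.

Lemma count_letters_read T (l : 'I_n) k :
  count_mem (val l) (flatten [seq letters T d | d <- take k cells]) = read_count T l k.
Proof.
rewrite count_flatten sumnE !big_map; apply: eq_bigr => d _.
exact: count_letters.
Qed.

Lemma lattice_column_word T :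
  lattice_word (nth 0%N mu) (map val (column_word T)) = lattice (mnm_of_part n mu) T.
Proof.
rewrite val_column_word; apply/idP/idP.
  move/(lattice_word_flatten (0%N, 0%N)) => wP.
  apply/negP => /existsP[k /existsP[l /and3P[l0 lT]]].
  have := wP k (ltn_ord k); rewrite lattice_word_decreasing ?letters_decreasing //.
  move=> /allP/(_ (val l)); rewrite mem_letters => /(_ lT).
  rewrite !mnmE (count_letters_read T l) -(count_letters_read T (opred l)) /=; lia.
move=> latT; apply/(lattice_word_flatten (0%N, 0%N)) => k ks.
rewrite lattice_word_decreasing ?letters_decreasing //; apply/allP => r /mapP[l].
rewrite mem_rev mem_enum => lT ->.
rewrite -implyNb; apply/implyP; rewrite -lt0n => l0; rewrite ltnNge.
apply: contra latT => h; apply/existsP; exists (Ordinal ks); apply/existsP; exists l.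
rewrite /violates l0 lT !mnmE /=.
by rewrite -(count_letters_read T l) -(count_letters_read T (opred l)).
Qed.

Lemma mem_lr_tableaux T : (size mu <= n)%N -> (size nu <= n)%N ->
  (T \in lr_tableaux n th mu nu) =
  [&& is_svt T, lattice (mnm_of_part n mu) T & (mnm_of_part n mu + weight T)%MM == mnm_of_part n nu].
Proof.
move=> smu snu; rewrite inE; congr (_ && _).
have cE (l : 'I_n) : count_mem (val l) (map val (column_word T)) = weight T l.
  by rewrite val_column_word -read_count_size -count_letters_read take_size.
apply/asboolP/andP => [/partition_chainP[wP E]|[wP /eqP/mnmP E]].
  split; first by rewrite -lattice_column_word.
  by apply/eqP/mnmP => i; rewrite mnmDE -cE !mnmE E.
apply/partition_chainP; split; first by rewrite lattice_column_word.
move=> i; have [iln|nli] := ltnP i n.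
  by have := E (Ordinal iln); rewrite mnmDE -cE !mnmE /= => ->.
(* Rows from [n] on are empty in both partitions, and no letter of the word reaches them. *)
rewrite !nth_default ?add0n //; try lia.
by apply/esym/count_memPn/negP => /mapP[l _ iE]; move: nli; rewrite iE leqNgt ltn_ord.
Qed.

End LatticeTableaux.

(** * Superstandard tableaux and structure coefficients *)

Section Superstandard.
Variables (n : nat) (la : intpart).
Hypothesis sla : (size la <= n)%N.
Implicit Types T : filling n la.
Notation cells := (cells la).
Notation cell k := (nth (0%N, 0%N) cells k).

Lemma mem_boxes_part i x : ((i, x) \in boxes la) = (x < nth 0 la i)%N.
Proof. by rewrite mem_boxes /= nth_nil. Qed.

Definition superstandard : filling n la := [ffun d => [set k : 'I_n | val k == (val d).1]].

Lemma entries_superstandard i x (k : 'I_n) :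
  (k \in entries superstandard i x) = (x < nth 0 la i)%N && (val k == i).
Proof.
rewrite -mem_boxes_part; have [bx|nb] := boolP ((i, x) \in boxes la).
  by have /= -> := entries_box superstandard (SeqSub bx); rewrite ffunE inE.
by rewrite entriesN // inE.
Qed.

Lemma box_row_lt i x : (i, x) \in boxes la -> (i < n)%N.
Proof. by move=> /boxes_bound[/= il _]; apply: leq_trans il sla. Qed.

Lemma superstandard_svt : is_svt superstandard.
Proof.
apply/svtP; split=> [i x k l|i x k l|i x bx].
- by rewrite !entries_superstandard => /andP[_ /eqP->] /andP[_ /eqP->].
- by rewrite !entries_superstandard => /andP[_ /eqP->] /andP[_ /eqP->].
- exists (Ordinal (box_row_lt bx)).
  by rewrite entries_superstandard -mem_boxes_part bx /=.
Qed.

Lemma num_entries_superstandard : num_entries superstandard = size (boxes la).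
Proof.
rewrite /num_entries -(card_seq_sub (uniq_boxes la)) -sum1_card; apply: eq_bigr => d _.
have dn : ((val d).1 < n)%N by apply: (@box_row_lt _ (val d).2); rewrite -surjective_pairing (valP d).
rewrite ffunE -(cards1 (Ordinal dn)); apply: eq_card => k.
by rewrite !inE -val_eqE.
Qed.

Lemma weight_superstandard : weight superstandard = mnm_of_part n la.
Proof.
apply/mnmP => k; rewrite weightE mnmE.
rewrite (sum_cells la xpredT (fun i x => (k \in entries superstandard i x) : nat)).
have [kl|lk] := ltnP k (size la); last first.
  rewrite nth_default // big1 // => i _; rewrite big1 // => x _.
  by rewrite entries_superstandard; case: eqP => [E|]; rewrite ?andbF //; have := ltn_ord i; rewrite -E ltnNge lk.
rewrite (bigD1 (Ordinal kl)) //= [X in (_ + X)%N]big1 ?addn0; last first.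
  move=> i /negP ik; rewrite big1 // => x _; rewrite entries_superstandard.
  by case: eqP => [E|]; rewrite ?andbF //; case: ik; apply/eqP/val_inj.
have hd : (nth 0 la k <= head 0%N la)%N by rewrite -nth0 nth_intpart_le.
transitivity (\sum_(x < nth 0%N la k) 1)%N; last by rewrite sum_nat_const card_ord muln1.
rewrite (big_ord_widen _ (fun=> 1%N) hd) [RHS]big_mkcond.
by apply: eq_bigr => x _; rewrite entries_superstandard eqxx andbT; case: (_ < _)%N.
Qed.

Lemma index_before q k : (k < size cells)%N -> q \in cells -> read_before q (cell k) ->
  exists2 k', (k' < k)%N & cell k' = q.
Proof.
move=> ks /(nthP (0%N, 0%N))[k' k's <-] qk; exists k' => //.
rewrite ltnNge leq_eqVlt; apply/negP => /orP[/eqP E|kk'].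
  by move: qk; rewrite E /read_before !ltnn andbF.
have := cell_before kk' k's; move: qk; rewrite /read_before.
by case: (cell k) (cell k') => [i x] [i' x'] /=; lia.
Qed.

Lemma mem_cells_box i x : (i, x) \in boxes la -> (i, x) \in cells.
Proof. by move=> /boxes_bound[iR xM]; rewrite mem_cells iR. Qed.

(** Moving a box up by one row maps the boxes with letter [l] read so far, together with the current
    one, injectively to boxes with the preceding letter that are already read. So the preceding
    letter is strictly ahead. *)
Lemma superstandard_lattice : lattice 0%MM superstandard.
Proof.
apply/negP => /existsP[k /existsP[l /and3P[l0]]].
rewrite !mnm0E !add0n; case kE: (cell k) => [r c] /=.
rewrite entries_superstandard => /andP[cl /eqP lr].
have row_count (i : 'I_n) : read_count superstandard i k =
    size [seq d <- take k cells | (d.2 < nth 0 la d.1)%N && (val i == d.1)].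
  rewrite size_filter -sum1_count [RHS]big_mkcond; apply: eq_bigr => d _.
  by rewrite entries_superstandard; case: ifP.
pose up (d : nat * nat) := (d.1.-1, d.2).
set A := [seq d <- take k cells | (d.2 < nth 0 la d.1)%N && (val l == d.1)].
set B := [seq d <- take k cells | (d.2 < nth 0 la d.1)%N && (val (opred l) == d.1)].
rewrite !row_count -/A -/B leqNgt => /negP[].
have Arow d : d \in (r, c) :: A -> d.1 = l.
  by rewrite inE => /predU1P[->//|]; rewrite mem_filter => /andP[/andP[_ /eqP]].
have upA : uniq (map up ((r, c) :: A)).
  rewrite map_inj_in_uniq => [|d d' /Arow dl /Arow dl' [_]]; last first.
    by case: d d' dl dl' => [i x] [i' x'] /= -> -> ->.
  rewrite /= filter_uniq ?take_uniq ?uniq_cells // andbT mem_filter negb_and.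
  apply/orP; right; apply/negP => /(mem_take_cells (ltn_ord k)).
  by rewrite kE /read_before /=; lia.
have upB : {subset map up ((r, c) :: A) <= B}.
  move=> _ /mapP[d dA ->]; have dl := Arow _ dA.
  have dbox : (d.2 < nth 0 la d.1)%N.
    by move: dA; rewrite inE => /predU1P[->//|]; rewrite mem_filter => /andP[/andP[]].
  have upbox : (d.2 < nth 0 la d.1.-1)%N.
    by apply: leq_trans dbox _; apply: nth_intpart_le; apply: leq_pred.
  rewrite mem_filter /= upbox dl eqxx /=.
  have [||k' k'k <-] := @index_before (up d) k (ltn_ord k).
  - by apply: mem_cells_box; rewrite mem_boxes_part.
  - rewrite kE; move: dA dl; rewrite inE => /predU1P[->|]; rewrite /read_before /=.
      by rewrite eqxx; lia.
    rewrite mem_filter => /andP[_ /(mem_take_cells (ltn_ord k))].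
    by rewrite kE /read_before /=; lia.
  - rewrite -(nth_take (0%N, 0%N) k'k); apply: mem_nth; rewrite size_take ltn_ord //.
by have := uniq_leq_size upA upB; rewrite size_map.
Qed.

(** Induction along the reading. The box above bounds the letters from below by the row index, and
    the box to the right bounds them from above. At the end of a row, a larger letter [l] would need
    its predecessor read before. By induction that happens only in the row of index [l - 1], which
    is not above the present one, hence no longer, and so has no box in the columns already
    finished. *)
Lemma lattice_superstandard T : is_svt T -> lattice 0%MM T -> T = superstandard.
Proof.
move=> Tsvt latT; have [row col ne] := svtP _ Tsvt.
have key k : (k < size cells)%N ->
    forall l : 'I_n, l \in entries T (cell k).1 (cell k).2 -> val l = (cell k).1.
  elim/ltn_ind: k => k IHk ks; case kE: (cell k) => [r c] /= l lT.
  have IH i x (u : 'I_n) : read_before (i, x) (r, c) -> u \in entries T i x -> val u = i.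
    move=> ix uT; have [||k' k'k k'E] := @index_before (i, x) k ks.
    - exact/mem_cells_box/(entries_in uT).
    - by rewrite kE.
    by have := IHk _ k'k (ltn_trans k'k ks) u; rewrite k'E; apply.
  have rc := entries_in lT; rewrite mem_boxes_part in rc.
  apply/eqP; rewrite eqn_leq; apply/andP; split; last first.
    case: (posnP r) => [->//|r0].
    have upbox : (r.-1, c) \in boxes la.
      by rewrite mem_boxes_part; apply: leq_trans rc _; apply: nth_intpart_le; apply: leq_pred.
    have [u uT] := ne _ _ upbox.
    have uE : val u = r.-1 by apply: IH uT; rewrite /read_before /= eqxx; lia.
    have := col r.-1 c u l uT; rewrite prednK // => /(_ lT).
    by move: uE => /= ->; rewrite prednK.
  have [rbox|nrbox] := boolP ((r, c.+1) \in boxes la).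
    have [u uT] := ne _ _ rbox.
    have uE : val u = r by apply: IH uT; rewrite /read_before /= ltnSn.
    by have := row _ _ _ _ lT uT; move: uE => /= ->.
  rewrite leqNgt; apply/negP => rl; case/negP: latT.
  apply/existsP; exists (Ordinal ks); apply/existsP; exists l.
  rewrite /violates (leq_ltn_trans _ rl) //= kE /= lT !mnm0E !add0n.
  rewrite [X in (X <= _)%N](_ : _ = 0%N) // /read_count big_seq big1 // => -[i x] ixk.
  apply/eqP; rewrite eqb0; apply/negP => /= jT.
  have := mem_take_cells ks ixk; rewrite kE => before.
  have /= iE := IH _ _ _ before jT.
  have := entries_in jT; move: nrbox before; rewrite !mem_boxes_part /read_before /= -leqNgt.
  have : (nth 0 la i <= nth 0 la r)%N by apply: nth_intpart_le; rewrite -iE; lia.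
  by move: iE rl; lia.
apply: filling_ext => i x; apply/setP => k; rewrite entries_superstandard -mem_boxes_part.
apply/idP/andP => [kT|[bx /eqP ki]].
  have bx := entries_in kT; split=> //; apply/eqP.
  have /(nthP (0%N, 0%N))[q qs qE] := mem_cells_box bx.
  by have := key q qs k; rewrite qE; apply.
have [u uT] := ne _ _ bx; have /(nthP (0%N, 0%N))[q qs qE] := mem_cells_box bx.
have := key q qs u; rewrite qE => /(_ uT) /= ui.
by rewrite (_ : k = u) //; apply: val_inj; rewrite /= ui.
Qed.

Lemma groth_alternant0 (K : comNzRingType) (b : K) :
  groth n la b * alternant b 0 = alternant b (mnm_of_part n la).
Proof.
rewrite groth_mul_alternant; last by apply/dominantP => i k _; rewrite !mnm0E.
rewrite (big_pred1 superstandard) => [|T /=].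
  by rewrite num_entries_superstandard subnn expr0 scale1r add0m weight_superstandard.
apply/andP/eqP => [[]|->]; first exact: lattice_superstandard.
by rewrite superstandard_svt superstandard_lattice.
Qed.

End Superstandard.

(** The first column would need more than [n] strictly increasing letters. *)
Lemma groth_eq0 n (mu : intpart) (K : comNzRingType) (b : K) : (n < size mu)%N ->
  groth n mu b = 0.
Proof.
move=> nmu; rewrite /groth big_pred0 // => T; apply/negP => /svtP[_ col ne].
have box i : (i < size mu)%N -> (i, 0%N) \in boxes mu.
  by move=> imu; rewrite mem_boxes_part nth_intpart_gt0.
have ge i (k : 'I_n) : (i < size mu)%N -> k \in entries T i 0 -> (i <= k)%N.
  elim: i k => // i IHi k imu kT.
  have [u uT] := ne _ _ (box i (ltnW imu)).
  exact: leq_ltn_trans (IHi _ (ltnW imu) uT) (col _ _ _ _ uT kT).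
have [k kT] := ne _ _ (box n nmu).
by have := ge _ _ nmu kT; rewrite leqNgt ltn_ord.
Qed.

Lemma grothendieckE (F : fieldType) n th : grothendieck F n th = groth n th (beta F).
Proof.
apply: eq_bigr => T _; congr (_ *: _).
rewrite mpolyXE_id.
transitivity (\prod_(k < n) \prod_b ('X_k : {mpoly {fraction {poly F}}[n]}) ^+ (k \in T b)).
  rewrite exchange_big /=; apply: eq_bigr => d _; rewrite big_mkcond.
  by apply: eq_bigr => k _; case: (k \in T d).
by apply: eq_bigr => k _; rewrite mnmE prodrXr.
Qed.

Lemma lr_tableaux_size n th (mu nu : intpart) : lr_tableaux n th mu nu != set0 ->
  (size mu <= size nu)%N.
Proof.
case/set0Pn => T; rewrite inE => /andP[_ /asboolP/partition_chainP[_ E]].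
rewrite leqNgt; apply/negP => h.
by have := nth_intpart_gt0 mu (size nu); have := E (size nu); rewrite h nth_default //; lia.
Qed.

(** * Comparison of coefficients *)

Section StructureCoefficients.
Variables (F : fieldType) (n : nat) (th : skew_diagram) (mu nu : intpart).
Hypothesis nu_le : (size nu <= n)%N.
Variable c : {fsfun intpart -> {fraction {poly F}} with 0}.
Hypothesis hc : is_structure_coeffs n th mu c.
Notation b := (beta F).

(** Multiplication of the defining identity by [alternant b 0] turns each Grothendieck polynomial of
    the expansion into an alternant. *)
Lemma structure_coeffs_alternant :
  groth n th b * (groth n mu b * alternant b 0) =
  \sum_(la <- finsupp c | (size la <= n)%N) c la *: alternant b (mnm_of_part n la).
Proof.
rewrite mulrA -!grothendieckE hc mulr_suml; apply: eq_bigr => la sla.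
by rewrite grothendieckE -scalerAl groth_alternant0.
Qed.

Lemma coeff_sum_part : \sum_(la <- finsupp c | (size la <= n)%N && (mnm_of_part n la == mnm_of_part n nu)) c la = c nu.
Proof.
rewrite (eq_bigl (pred1 nu)); last first.
  move=> la /=; apply/andP/eqP => [[sla /eqP]|->//]; exact: mnm_of_part_inj.
have [nuc|nnu] := boolP (nu \in finsupp c).
  by rewrite -big_filter filter_pred1_uniq ?fset_uniq // big_seq1.
rewrite fsfun_dflt // big_seq_cond big1 // => la /andP[lac /eqP lanu].
by rewrite -lanu lac in nnu.
Qed.

Lemma structure_coeff_lattice : (size mu <= n)%N ->
  c nu = \sum_(T : filling n th | T \in lr_tableaux n th mu nu)
           b ^+ (num_entries T - size (boxes th)).
Proof.
move=> smu; have := structure_coeffs_alternant.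
rewrite groth_alternant0 // groth_mul_alternant ?dominant_mnm_of_part // => eqA.
pose Ts := [seq T <- index_enum {ffun seq_sub (boxes th) -> {set 'I_n}} | is_svt T && lattice (mnm_of_part n mu) T].
(* Both expansions of the product in one list, the tableau terms negated, so that independence
   applies to their difference. *)
pose r := [seq (c la, mnm_of_part n la) | la <- enum_fset (finsupp c) & (size (parts la) <= n)%N] ++
  [seq (- b ^+ (num_entries T - size (boxes th)), (mnm_of_part n mu + weight T)%MM) | T : filling n th <- Ts].
have rdom x : x \in r -> dominant x.2.
  rewrite mem_cat => /orP[/mapP[la _ ->]|/mapP[T]] /=; first exact: dominant_mnm_of_part.
  rewrite mem_filter => /andP[/andP[_ latT] _] ->; apply: lattice_dominant => //.
  exact: dominant_mnm_of_part.
have r0 : \sum_(x <- r) x.1 *: alternant b x.2 = 0.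
  rewrite big_cat !big_map !big_filter /= -eqA -big_split /= big1 // => T _.
  by rewrite -scalerDl subrr scale0r.
have := alternant_indep rdom r0 (mnm_of_part n nu).
rewrite big_cat !big_map !big_filter_cond /= coeff_sum_part => /eqP.
rewrite sumrN subr_eq0 => /eqP->; apply: eq_bigl => T.
by rewrite mem_lr_tableaux // andbA.
Qed.

Lemma structure_coeff_eq0 : (n < size mu)%N -> c nu = 0.
Proof.
move=> nmu; have := structure_coeffs_alternant.
rewrite (groth_eq0 _ nmu) mul0r mulr0 => /esym eqA.
pose r := [seq (c la, mnm_of_part n la) | la <- enum_fset (finsupp c) & (size (parts la) <= n)%N].
have rdom x : x \in r -> dominant x.2 by case/mapP => la _ ->; apply: dominant_mnm_of_part.
have r0 : \sum_(x <- r) x.1 *: alternant b x.2 = 0 by rewrite big_map big_filter.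
have := alternant_indep rdom r0 (mnm_of_part n nu).
by rewrite big_map big_filter_cond coeff_sum_part.
Qed.

End StructureCoefficients.

Theorem theorem6p7 (n : nat) (n_gt0 : (0 < n)%N) (F : fieldType)
    (th : skew_diagram) (mu nu : intpart) (nu_le : (size nu <= n)%N)
    (c : {fsfun intpart -> {fraction {poly F}} with 0})
    (hc : is_structure_coeffs n th mu c) :
  c nu = beta F ^ ((sumn nu)%:Z - (sumn mu)%:Z - (size (boxes th))%:Z)
           *+ #|lr_tableaux n th mu nu|.
Proof.
(* If [mu] has more than [n] rows, its Grothendieck polynomial is 0; as shapes only grow along a
   chain, none ends at [nu], and both sides vanish. *)
have [smu|nmu] := leqP (size mu) n; last first.
  rewrite (structure_coeff_eq0 nu_le hc nmu).
  have [->|/lr_tableaux_size] := eqVneq (lr_tableaux n th mu nu) set0.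
    by rewrite cards0.
  by move=> munu; have := leq_trans nmu (leq_trans munu nu_le); rewrite ltnn.
rewrite (structure_coeff_lattice nu_le hc smu) -sumr_const; apply: eq_bigr => T.
rewrite mem_lr_tableaux // => /and3P[Tsvt _ /eqP/(congr1 mdeg)].
(* Taking degrees shows that every counted tableau has [sumn nu - sumn mu] entries, so the truncated
   exponent agrees with the integer one. *)
rewrite mdegD mdeg_weight !mdeg_mnm_of_part // => E; rewrite exprnP; congr (_ ^ _).
by have := num_entries_ge Tsvt; lia.
Qed.
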